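(* Let $\mathbb{F}$ be a field of characteristic different from $2$, let $\mathcal{C}$ be a Cayley algebra over $\mathbb{F}$, and let $(\mathrm{T}(\mathcal{C}),-)$ be the associated Smirnov algebra with its involution. Then the automorphism group schemes $\mathbf{Aut}(\mathcal{C})$ and $\mathbf{Aut}(\mathrm{T}(\mathcal{C}),-)$ are isomorphic.
   Context: A Cayley algebra is an $8$-dimensional unital algebra with a nondegenerate multiplicative quadratic form $n$; write $n(x,y)=n(x+y)-n(x)-n(y)$, $\bar x=n(x,1)1-x$, and let $\mathcal{S}=\{x\in\mathcal{C}:\bar x=-x\}$ ($\dim\mathcal{S}=7$), which is closed under the commutator $[x,y]=xy-yx$ of $\mathcal{C}$. Smirnov algebra: let $\mathcal{H}=(\mathcal{S}\otimes\mathcal{S})/M$, with $M=\mathrm{span}\{s_1\otimes s_2-s_2\otimes s_1\}$, and write $s_1\times s_2$ for the class of $s_1\otimes s_2$. On $\mathrm{T}(\mathcal{C})=\mathcal{H}\oplus\mathcal{S}$ define a commutative product $\odot$ and an anticommutative product $[\cdot,\cdot]$ by, for $s,s_i\in\mathcal{S}$, $$s_1\odot s_2=s_1\times s_2,\qquad s\odot(s_1\times s_2)=-n(s_1,s_2)s-\tfrac12\big(n(s,s_1)s_2+n(s,s_2)s_1\big),$$ $$(s_1\times s_2)\odot(s_3\times s_4)=\tfrac14\big([s_1,s_3]\times[s_2,s_4]+[s_1,s_4]\times[s_2,s_3]\big)-n(s_1,s_2)\,s_3\times s_4-n(s_3,s_4)\,s_1\times s_2,$$ $[s_1,s_2]$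 equal to the commutator in $\mathcal{C}$, $\ [s,s_1\times s_2]=[s,s_1]\times s_2+s_1\times[s,s_2]$, and $$[s_1\times s_2,s_3\times s_4]=-\tfrac12\big(n(s_1,s_3)[s_2,s_4]+n(s_1,s_4)[s_2,s_3]+n(s_2,s_3)[s_1,s_4]+n(s_2,s_4)[s_1,s_3]\big).$$ The product of $\mathrm{T}(\mathcal{C})$ is $xy=x\odot y+\tfrac12[x,y]$, and its involution is $h+s\mapsto h-s$ ($h\in\mathcal{H}$, $s\in\mathcal{S}$). It is a $35$-dimensional unital algebra with involution. $\mathbf{Aut}(\mathcal{C})$ is the affine group scheme $R\mapsto\mathrm{Aut}_R(\mathcal{C}\otimes R)$, for commutative associative unital $\mathbb{F}$-algebras $R$, and $\mathbf{Aut}(\mathrm{T}(\mathcal{C}),-)(R)$ is the group of $R$-algebra automorphisms of $\mathrm{T}(\mathcal{C})\otimes R$ commuting with the ($R$-linearly extended) involution. *)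

(* Defs.v *)
From HB Require Import structures.
From mathcomp Require Import all_boot all_order all_algebra.
From mathcomp Require Import sesquilinear.
From mathcomp Require Import boolp ring.

Set Implicit Arguments.
Unset Strict Implicit.
Unset Printing Implicit Defensive.

Import GRing.Theory.
Local Open Scope ring_scope.

(* A commutative associative unital F-algebra, given by its structure
   morphism.  The zero ring is allowed, hence [comPzRingType] rather than
   [comAlgType F], whose members are nontrivial. *)
Record commAlg (F : fieldType) := CommAlg {
  calg_sort :> comPzRingType;
  calg_in : {rmorphism F -> calg_sort}
}.

Record commAlgHom (F : fieldType) (R S : commAlg F) := CommAlgHom {
  cahom_fun :> {rmorphism R -> S};
  cahom_in : forall a : F, cahom_fun (calg_in R a) = calg_in S a
}.

Definition commAlg_id (F : fieldType) (R : commAlg F) : commAlgHom R R :=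
  @CommAlgHom F R R (idfun : {rmorphism R -> R}) (fun=> erefl).

Definition commAlg_comp (F : fieldType) (R S T : commAlg F)
    (g : commAlgHom S T) (f : commAlgHom R S) : commAlgHom R T :=
  @CommAlgHom F R T (g \o f : {rmorphism R -> T})
    (fun a => etrans (congr1 g (cahom_in f a)) (cahom_in g a)).

(* A group scheme over F, through its functor of points. *)
Record groupFunctor (F : fieldType) := GroupFunctor {
  gf_obj :> commAlg F -> groupType;
  gf_map : forall R S, commAlgHom R S -> {multiplicative gf_obj R -> gf_obj S};
  gf_map_id : forall R, gf_map (commAlg_id R) =1 id;
  gf_map_comp : forall R S T (g : commAlgHom S T) (f : commAlgHom R S),
    gf_map (commAlg_comp g f) =1 gf_map g \o gf_map f
}.

Record gfHom (F : fieldType) (G H : groupFunctor F) := GfHom {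
  gf_comp :> forall R, {multiplicative G R -> H R};
  gf_natural : forall R S (f : commAlgHom R S) (x : G R),
    gf_comp S (gf_map G f x) = gf_map H f (gf_comp R x)
}.

Definition gf_isomorphic (F : fieldType) (G H : groupFunctor F) : Prop :=
  exists (Phi : gfHom G H) (Psi : gfHom H G),
    forall R, cancel (Phi R) (Psi R) /\ cancel (Psi R) (Phi R).

Section Basis.
Variables (F : fieldType) (V : vectType F).

Definition bas (i : 'I_(\dim {:V})) : V := (vbasis {:V})`_i.
Definition crd (v : V) (i : 'I_(\dim {:V})) : F := coord (vbasis {:V}) i v.

Lemma crd_sum v : v = \sum_i crd v i *: bas i.
Proof. exact: (coord_vbasis (memvf v)). Qed.

Lemma crd_bas i j : crd (bas i) j = (i == j)%:R.
Proof. by rewrite /crd /bas coord_free ?(basis_free (vbasisP _)) // eq_sym. Qed.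

Lemma crdP a u v i : crd (a *: u + v) i = a * crd u i + crd v i.
Proof. by rewrite /crd linearP. Qed.

End Basis.

(* [ext R V] is V (x)_F R for a finite-dimensional V: the free R-module of
   coordinate vectors in a fixed basis of V, with v (x) r = r *: ext_in R v.  Its
   universal property is given by [ext_lift_in] and [ext_lift_unique]. *)
Notation ext R V := 'rV[calg_sort R]_(\dim {:V}).

Section ScalarExtension.
Variables (F : fieldType) (R : commAlg F).
Implicit Types U V W : vectType F.

Definition ext_in (V : vectType F) (v : V) : ext R V :=
  \row_i calg_in R (crd v i).

Definition ext_lift (V : vectType F) (N : lmodType R) (f : V -> N)
    (x : ext R V) : N := \sum_i x 0 i *: f (bas i).

Definition ext_lin (V W : vectType F) (f : V -> W) : ext R V -> ext R W :=
  ext_lift (fun v => ext_in (f v)).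

Definition ext_bil (U V W : vectType F) (m : U -> V -> W)
    (x : ext R U) (y : ext R V) : ext R W :=
  \sum_i \sum_j (x 0 i * y 0 j) *: ext_in (m (bas i) (bas j)).

Lemma ext_inP V a (u v : V) :
  ext_in (a *: u + v) = calg_in R a *: ext_in u + ext_in v.
Proof. by apply/rowP => i; rewrite !mxE crdP rmorphD rmorphM. Qed.

Lemma ext_in_bas V i : ext_in (bas i) = delta_mx 0 i :> ext R V.
Proof.
by apply/rowP => j; rewrite !mxE crd_bas eqxx eq_sym rmorph_nat.
Qed.

Lemma ext_sum V (x : ext R V) : x = \sum_i x 0 i *: ext_in (bas i).
Proof.
by rewrite {1}[x]row_sum_delta; apply: eq_bigr => i _; rewrite ext_in_bas.
Qed.

Lemma ext_lift_linear V (N : lmodType R) (f : V -> N) : linear (ext_lift f).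
Proof.
move=> a x y; rewrite /ext_lift scaler_sumr -big_split.
by apply: eq_bigr => i _; rewrite !mxE scalerDl scalerA.
Qed.

HB.instance Definition _ V (N : lmodType R) (f : V -> N) :=
  GRing.isLinear.Build R (ext R V) N _ (ext_lift f) (@ext_lift_linear V N f).

Lemma ext_lift_in V (N : lmodType R) (f : V -> N) :
    (forall a u v, f (a *: u + v) = calg_in R a *: f u + f v) ->
  forall v, ext_lift f (ext_in v) = f v.
Proof.
move=> fP v.
have fD u w : f (u + w) = f u + f w.
  by rewrite -[u in LHS]scale1r fP rmorph1 scale1r.
have f0 : f 0 = 0 by apply: (addrI (f 0)); rewrite -fD !addr0.
rewrite [v in RHS]crd_sum /ext_lift (big_morph f fD f0).
apply: eq_bigr => i _.
by rewrite -[_ *: _ in RHS]addr0 fP f0 addr0 mxE.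
Qed.

Lemma ext_lift_unique V (N : lmodType R) (g h : ext R V -> N) :
  linear g -> linear h -> (forall v, g (ext_in v) = h (ext_in v)) -> g =1 h.
Proof.
move=> gL hL gh x.
pose gl := GRing.isLinear.Build R (ext R V) N _ g gL.
pose hl := GRing.isLinear.Build R (ext R V) N _ h hL.
pose G : {linear ext R V -> N} := HB.pack g gl.
pose H : {linear ext R V -> N} := HB.pack h hl.
rewrite (ext_sum x) -[g]/(G : _ -> _) -[h]/(H : _ -> _) !linear_sum.
by apply: eq_bigr => i _; rewrite !linearZ /= gh.
Qed.

Lemma ext_lin_linear V W (f : V -> W) : linear (ext_lin f).
Proof. exact: ext_lift_linear. Qed.

HB.instance Definition _ V W (f : V -> W) :=
  GRing.isLinear.Build R (ext R V) (ext R W) _ (ext_lin f)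
    (@ext_lin_linear V W f).

Lemma ext_lin_in V W (f : {linear V -> W}) v :
  ext_lin f (ext_in v) = ext_in (f v).
Proof. by apply: ext_lift_in => a u w; rewrite linearP ext_inP. Qed.

Lemma ext_bil_linearl U V W (m : U -> V -> W) y : linear (ext_bil m ^~ y).
Proof.
move=> a x x'; rewrite /ext_bil scaler_sumr -big_split; apply: eq_bigr => i _.
rewrite scaler_sumr -big_split; apply: eq_bigr => j _.
by rewrite !mxE scalerA mulrDl scalerDl mulrA.
Qed.

Lemma ext_bil_linearr U V W (m : U -> V -> W) x : linear (ext_bil m x).
Proof.
move=> a y y'; rewrite /ext_bil scaler_sumr -big_split; apply: eq_bigr => i _.
rewrite scaler_sumr -big_split; apply: eq_bigr => j _.
by rewrite !mxE scalerA mulrDr scalerDl mulrCA mulrA.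
Qed.

Lemma ext_bil_in (U V W : vectType F) (m : {bilinear U -> V -> W}) u v :
  ext_bil m (ext_in u) (ext_in v) = ext_in (m u v).
Proof.
have e0 : ext_in (0 : W) = 0.
  by apply/rowP => i; rewrite !mxE /crd linear0 rmorph0.
have eD : {morph @ext_in W : x y / x + y}.
  by move=> x y; rewrite -[x in LHS]scale1r ext_inP rmorph1 scale1r.
rewrite [u in RHS]crd_sum [v in RHS]crd_sum linear_sumlz (big_morph _ eD e0).
apply: eq_bigr => i _; rewrite linear_sumr (big_morph _ eD e0).
apply: eq_bigr => j _; rewrite linearZl_LR linearZr_LR scalerA.
by rewrite -[_ *: _ in RHS]addr0 ext_inP e0 addr0 rmorphM !mxE.
Qed.

End ScalarExtension.

Arguments ext_in {F} R {V} v.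
Arguments ext_lin {F} R {V W} f x.
Arguments ext_bil {F} R {U V W} m x y.

(* A finite-dimensional algebra, not necessarily associative or unital. *)
Record nalg (F : fieldType) := NAlg {
  nalg_sort :> vectType F;
  nalg_mul : {bilinear nalg_sort -> nalg_sort -> nalg_sort}
}.

Section AutomorphismFunctor.
Variables (F : fieldType) (A : nalg F) (ops : seq 'End(A)).
Implicit Types R S T : commAlg F.

(* R-algebra automorphisms of A (x) R commuting with the R-linear extensions of
   the operators in [ops]. *)
Record ext_aut (R : commAlg F) := ExtAut {
  aut_fun :> ext R A -> ext R A;
  aut_linear : linear aut_fun;
  aut_bijective : bijective aut_fun;
  aut_mul : {morph aut_fun : x y / ext_bil R (nalg_mul A) x y};
  aut_ops : forall op, op \in ops -> {morph aut_fun : x / ext_lin R op x}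
}.

Lemma ext_autP R (f g : ext_aut R) : f =1 g -> f = g.
Proof.
case: f g => [f fl fb fm fo] [g gl gb gm go] /= /funext fg; subst g.
by congr ExtAut; exact: Prop_irrelevance.
Qed.

HB.instance Definition _ R := gen_eqMixin (ext_aut R).
HB.instance Definition _ R := gen_choiceMixin (ext_aut R).

HB.instance Definition _ R (f : ext_aut R) :=
  GRing.isLinear.Build R (ext R A) (ext R A) _ f (aut_linear f).

Lemma aut_one_linear R : linear (@id (ext R A)). Proof. by []. Qed.

Definition aut_one R : ext_aut R :=
  @ExtAut R id (@aut_one_linear R) (Bijective (@erefl _) (@erefl _))
    (fun _ _ => erefl) (fun _ _ _ => erefl).

Section Comp.
Variables (R : commAlg F) (f g : ext_aut R).

Lemma aut_comp_linear : linear (f \o g).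
Proof. by move=> a x y /=; rewrite !linearP. Qed.
Lemma aut_comp_mul : {morph f \o g : x y / ext_bil R (nalg_mul A) x y}.
Proof. by move=> x y /=; rewrite !aut_mul. Qed.
Lemma aut_comp_ops op : op \in ops -> {morph f \o g : x / ext_lin R op x}.
Proof. by move=> opP x /=; rewrite !(aut_ops _ opP). Qed.

Definition aut_comp : ext_aut R :=
  ExtAut aut_comp_linear (bij_comp (aut_bijective f) (aut_bijective g))
    aut_comp_mul aut_comp_ops.

End Comp.

Lemma aut_inv_exists R (f : ext_aut R) :
  exists g : ext_aut R, cancel f g /\ cancel g f.
Proof.
case: (aut_bijective f) => g fK gK; have fI := can_inj fK.
have gl : linear g by move=> a x y; apply: fI; rewrite aut_linear !gK.
have gb : bijective g by exists f.
have gm : {morph g : x y / ext_bil R (nalg_mul A) x y}.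
  by move=> x y; apply: fI; rewrite aut_mul !gK.
have go op : op \in ops -> {morph g : x / ext_lin R op x}.
  by move=> opP x; apply: fI; rewrite (aut_ops f opP) !gK.
by exists (@ExtAut R g gl gb gm go); split.
Qed.

Definition aut_inv R (f : ext_aut R) : ext_aut R :=
  projT1 (cid (aut_inv_exists f)).

Lemma aut_invK R (f : ext_aut R) : cancel f (aut_inv f).
Proof. by case: (projT2 (cid (aut_inv_exists f))). Qed.

Lemma aut_invVK R (f : ext_aut R) : cancel (aut_inv f) f.
Proof. by case: (projT2 (cid (aut_inv_exists f))). Qed.

Lemma aut_compA R : associative (@aut_comp R).
Proof. by move=> f g h; apply: ext_autP. Qed.
Lemma aut_comp1f R : left_id (aut_one R) (@aut_comp R).
Proof. by move=> f; apply: ext_autP. Qed.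
Lemma aut_compf1 R : right_id (aut_one R) (@aut_comp R).
Proof. by move=> f; apply: ext_autP. Qed.
Lemma aut_compVf R : left_inverse (aut_one R) (@aut_inv R) (@aut_comp R).
Proof. by move=> f; apply: ext_autP => x /=; rewrite aut_invK. Qed.
Lemma aut_compfV R : right_inverse (aut_one R) (@aut_inv R) (@aut_comp R).
Proof. by move=> f; apply: ext_autP => x /=; rewrite aut_invVK. Qed.

HB.instance Definition _ R := isGroup.Build (ext_aut R)
  (@aut_compA R) (@aut_comp1f R) (@aut_compf1 R) (@aut_compVf R) (@aut_compfV R).

Section Map.
Variables (R S : commAlg F) (h : commAlgHom R S).
Implicit Types U V W : vectType F.

(* f |-> f (x)_R S, the S-linear map sending a (x) 1 to (id (x) h) (f (a (x) 1)) *)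
Definition aut_map_fun (f : ext R A -> ext R A) : ext S A -> ext S A :=
  ext_lift (fun a => map_mx h (f (ext_in R a))).

Lemma aut_map_fun_linear f : linear (aut_map_fun f).
Proof. exact: ext_lift_linear. Qed.

HB.instance Definition _ f :=
  GRing.isLinear.Build S (ext S A) (ext S A) _ (aut_map_fun f)
    (@aut_map_fun_linear f).

Let map_rvZ n a (x : 'rV[R]_n) : map_mx h (a *: x) = h a *: map_mx h x.
Proof. by apply/rowP => i; rewrite !mxE rmorphM. Qed.

Let map_rv_sum n I (r : seq I) (x : I -> 'rV[R]_n) :
  map_mx h (\sum_(i <- r) x i) = \sum_(i <- r) map_mx h (x i).
Proof. exact: (raddf_sum (map_mx h)). Qed.

Lemma map_ext_in V (v : V) : map_mx h (ext_in R v) = ext_in S v.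
Proof. by apply/rowP => i; rewrite !mxE cahom_in. Qed.

Lemma map_ext_lift V W (f : V -> ext R W) (x : ext R V) :
  map_mx h (ext_lift f x) = ext_lift (fun v => map_mx h (f v)) (map_mx h x).
Proof.
rewrite /ext_lift map_rv_sum; apply: eq_bigr => i _.
by rewrite map_rvZ mxE.
Qed.

Lemma map_ext_lin V W (f : V -> W) (x : ext R V) :
  map_mx h (ext_lin R f x) = ext_lin S f (map_mx h x).
Proof.
rewrite /ext_lin map_ext_lift; congr ext_lift.
by apply/funext => v; rewrite map_ext_in.
Qed.

Lemma map_ext_bil U V W (m : U -> V -> W) (x : ext R U) (y : ext R V) :
  map_mx h (ext_bil R m x y) = ext_bil S m (map_mx h x) (map_mx h y).
Proof.
rewrite /ext_bil map_rv_sum; apply: eq_bigr => i _.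
rewrite map_rv_sum; apply: eq_bigr => j _.
by rewrite map_rvZ map_ext_in rmorphM !mxE.
Qed.

Lemma aut_map_fun_map f : linear f ->
  forall x, aut_map_fun f (map_mx h x) = map_mx h (f x).
Proof.
move=> fl x; pose fli := GRing.isLinear.Build R (ext R A) (ext R A) _ f fl.
pose f' : {linear ext R A -> ext R A} := HB.pack f fli.
rewrite [x in RHS]ext_sum -[f in RHS]/(f' : _ -> _) linear_sum map_rv_sum.
by apply: eq_bigr => i _; rewrite linearZ map_rvZ mxE.
Qed.

Lemma aut_map_funK f g : linear f -> linear g -> cancel f g ->
  cancel (aut_map_fun f) (aut_map_fun g).
Proof.
move=> fl gl fK.
have cl : linear (aut_map_fun g \o aut_map_fun f).
  by move=> a x y /=; rewrite !linearP.
apply: (ext_lift_unique cl (h := id)) => // v.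
by rewrite /= -map_ext_in !aut_map_fun_map // fK.
Qed.

Lemma aut_map_bijective (f : ext_aut R) : bijective (aut_map_fun f).
Proof.
exists (aut_map_fun (aut_inv f)); apply: aut_map_funK; try exact: aut_linear.
  exact: aut_invK.
exact: aut_invVK.
Qed.

Lemma aut_map_mul (f : ext_aut R) :
  {morph aut_map_fun f : x y / ext_bil S (nalg_mul A) x y}.
Proof.
move=> x y; move: x.
apply: ext_lift_unique => [a x x'|a x x'|u].
- by rewrite ext_bil_linearl linearP.
- by rewrite linearP ext_bil_linearl.
move: y; apply: ext_lift_unique => [a x x'|a x x'|v].
- by rewrite ext_bil_linearr linearP.
- by rewrite linearP ext_bil_linearr.
rewrite -!map_ext_in -map_ext_bil !aut_map_fun_map; try exact: aut_linear.
by rewrite aut_mul map_ext_bil.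
Qed.

Lemma aut_map_ops (f : ext_aut R) op : op \in ops ->
  {morph aut_map_fun f : x / ext_lin S op x}.
Proof.
move=> opP.
apply: ext_lift_unique => [a x y|a x y|v].
- by rewrite ext_lin_linear aut_map_fun_linear.
- by rewrite aut_map_fun_linear ext_lin_linear.
rewrite -map_ext_in -map_ext_lin !aut_map_fun_map; try exact: aut_linear.
by rewrite (aut_ops _ opP) map_ext_lin.
Qed.

Definition aut_map (f : ext_aut R) : ext_aut S :=
  ExtAut (@aut_map_fun_linear f) (aut_map_bijective f) (aut_map_mul f)
    (aut_map_ops f).

Lemma aut_mapM : {morph aut_map : f g / (f * g)%g}.
Proof.
move=> f g; apply: ext_autP.
apply: ext_lift_unique => [||v]; try exact: aut_linear.
rewrite /= -map_ext_in (aut_map_fun_map (aut_linear (f * g)%g)).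
by rewrite !aut_map_fun_map //; exact: aut_linear.
Qed.

HB.instance Definition _ :=
  isMultiplicative.Build (ext_aut R) (ext_aut S) aut_map aut_mapM.

End Map.

Lemma aut_map_id R : aut_map (commAlg_id R) =1 id.
Proof.
move=> f; apply: ext_autP.
apply: ext_lift_unique => [||v]; try exact: aut_linear.
rewrite -{1}(map_ext_in (commAlg_id R)) /= aut_map_fun_map ?map_mx_id //.
exact: aut_linear.
Qed.

Lemma aut_map_comp R S T (g : commAlgHom S T) (h : commAlgHom R S) :
  aut_map (commAlg_comp g h) =1 aut_map g \o aut_map h.
Proof.
move=> f; apply: ext_autP.
apply: ext_lift_unique => [||v]; try exact: aut_linear.
have := aut_map_fun_map (commAlg_comp g h) (aut_linear f) (ext_in R v).
rewrite map_ext_in /= => ->.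
rewrite -(map_ext_in g) aut_map_fun_map; last exact: aut_map_fun_linear.
rewrite -(map_ext_in h) aut_map_fun_map; last exact: aut_linear.
by rewrite -map_mx_comp.
Qed.

Definition AutOps : groupFunctor F :=
  @GroupFunctor F (fun R => ext_aut R : groupType)
    (fun R S h => aut_map h : {multiplicative ext_aut R -> ext_aut S})
    aut_map_id aut_map_comp.

End AutomorphismFunctor.

Definition AutGS (F : fieldType) (A : nalg F) : groupFunctor F :=
  AutOps (A := A) [::].

Definition AutInvGS (F : fieldType) (A : nalg F) (inv : 'End(A)) :
    groupFunctor F :=
  AutOps [:: inv].

(* [tensor V W] is V (x) W, with v (x) w = tens v w. *)
Notation tensor V W := 'M_(\dim {:V}, \dim {:W}).

Section Tensor.
Variables (F : fieldType) (V W : vectType F).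

Definition tens (v : V) (w : W) : tensor V W :=
  \matrix_(i, j) (crd v i * crd w j).

Definition tlift (U : lmodType F) (f : V -> W -> U) (A : tensor V W) : U :=
  \sum_i \sum_j A i j *: f (bas i) (bas j).

Lemma tens_bilinear : bilinear_for *:%R *:%R tens.
Proof.
split=> [w|v] a x y; apply/matrixP => i j; rewrite !mxE crdP.
  by rewrite mulrDl mulrA.
by rewrite mulrDr mulrCA.
Qed.

HB.instance Definition _ :=
  bilinear_isBilinear.Build F V W (tensor V W) *:%R *:%R tens tens_bilinear.

Lemma tens_sum (A : tensor V W) : A = \sum_i \sum_j A i j *: tens (bas i) (bas j).
Proof.
rewrite {1}[A]matrix_sum_delta; apply: eq_bigr => i _; apply: eq_bigr => j _.
congr (_ *: _); apply/matrixP => k l; rewrite !mxE !crd_bas.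
by rewrite -natrM mulnb (eq_sym i) (eq_sym j).
Qed.

Lemma tlift_linear (U : lmodType F) (f : V -> W -> U) : linear (tlift f).
Proof.
move=> a A B; rewrite /tlift scaler_sumr -big_split; apply: eq_bigr => i _.
rewrite scaler_sumr -big_split; apply: eq_bigr => j _.
by rewrite !mxE scalerDl scalerA.
Qed.

HB.instance Definition _ (U : lmodType F) (f : V -> W -> U) :=
  GRing.isLinear.Build F (tensor V W) U _ (tlift f) (@tlift_linear U f).

Lemma tliftP (U : lmodType F) a (f g h : V -> W -> U) A :
  (forall v w, f v w = a *: g v w + h v w) ->
  tlift f A = a *: tlift g A + tlift h A.
Proof.
move=> fgh; rewrite /tlift scaler_sumr -big_split; apply: eq_bigr => i _.
rewrite scaler_sumr -big_split; apply: eq_bigr => j _.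
by rewrite fgh scalerDr !scalerA mulrC.
Qed.

Lemma tlift_tens (U : lmodType F) (f : V -> W -> U) v w :
  bilinear_for *:%R *:%R f -> tlift f (tens v w) = f v w.
Proof.
move=> fP.
pose mix := bilinear_isBilinear.Build F V W U *:%R *:%R f fP.
pose f' : {bilinear V -> W -> U} := HB.pack f mix.
rewrite [v in RHS]crd_sum [w in RHS]crd_sum -[f in RHS]/(f' : _ -> _ -> _).
rewrite linear_sumlz; apply: eq_bigr => i _.
rewrite linear_sumr; apply: eq_bigr => j _.
by rewrite linearZl_LR linearZr_LR scalerA mxE.
Qed.

End Tensor.

(* V / U, realized on the complement U^C of U. *)
Section Quotient.
Variables (F : fieldType) (V : vectType F) (U : {vspace V}).

Definition quot : vectType F := subvs_of (U^C)%VS.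
Definition qproj (v : V) : quot := vsproj (U^C)%VS (daddv_pi (U^C)%VS U v).
Definition qrepr (q : quot) : V := vsval q.

Lemma qproj_linear : linear qproj.
Proof. by move=> a u v; rewrite /qproj !linearP. Qed.

HB.instance Definition _ := GRing.isLinear.Build F V quot _ qproj qproj_linear.

Lemma qrepr_linear : linear qrepr.
Proof. by move=> a u v; rewrite /qrepr linearP. Qed.

HB.instance Definition _ := GRing.isLinear.Build F quot V _ qrepr qrepr_linear.

Let capCU : (U^C :&: U = 0)%VS. Proof. by rewrite capvC capv_compl. Qed.

Lemma qreprK : cancel qrepr qproj.
Proof.
by move=> q; rewrite /qproj daddv_pi_id ?vsvalK ?subvsP.
Qed.

Lemma qproj_eq0 v : (qproj v == 0) = (v \in U).
Proof.
have vE : daddv_pi (U^C)%VS U v + daddv_pi U (U^C)%VS v = v.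
  by rewrite daddv_pi_add // addvC addv_complf memvf.
apply/eqP/idP => [v0|Uv].
  have := congr1 vsval v0; rewrite /qproj vsprojK ?memv_pi // linear0 => p0.
  by rewrite -vE p0 add0r memv_pi.
apply: subvs_inj; rewrite /qproj vsprojK ?memv_pi // linear0.
move: vE; rewrite (daddv_pi_id (capv_compl U) Uv) => /eqP.
by rewrite -subr_eq0 addrK => /eqP.
Qed.

Lemma qreprB v : qrepr (qproj v) - v \in U.
Proof. by rewrite -qproj_eq0 linearB /= qreprK subrr. Qed.

End Quotient.

Definition polar (F : fieldType) (V : vectType F) (q : V -> F) (x y : V) : F :=
  q (x + y) - q x - q y.

Definition quadratic (F : fieldType) (V : vectType F) (q : V -> F) : Prop :=
  (forall a x, q (a *: x) = a ^+ 2 * q x) /\ (forall y, scalar (polar q ^~ y)).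

(* Nondegeneracy of the polar form; in characteristic 2 this is stronger than
   nonsingularity of the quadratic form. *)
Definition nondegenerate (F : fieldType) (V : vectType F) (q : V -> F) : Prop :=
  forall x, (forall y, polar q x y = 0) -> x = 0.

Record cayley (F : fieldType) := Cayley {
  cay_nalg :> nalg F;
  cay_one : cay_nalg;
  cay_norm : cay_nalg -> F;
  cay_dim : \dim {:cay_nalg} = 8;
  cay_mul1 : left_id cay_one (nalg_mul cay_nalg);
  cay_mulr1 : right_id cay_one (nalg_mul cay_nalg);
  cay_quadratic : quadratic cay_norm;
  cay_nondegenerate : nondegenerate cay_norm;
  cay_normM : forall x y,
    cay_norm (nalg_mul cay_nalg x y) = cay_norm x * cay_norm y
}.

Section LinearClosure.
Variables (F : fieldType) (V W X Y : lmodType F).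
Implicit Types (f g : V -> W).

Lemma linD f g : linear f -> linear g -> linear (fun x => f x + g x).
Proof. by move=> fL gL a x y; rewrite fL gL scalerDr addrACA. Qed.

Lemma linN f : linear f -> linear (fun x => - f x).
Proof. by move=> fL a x y; rewrite fL opprD scalerN. Qed.

Lemma linZ c f : linear f -> linear (fun x => c *: f x).
Proof. by move=> fL a x y; rewrite fL scalerDr !scalerA mulrC. Qed.

Lemma linZl (f : V -> F) (w : W) : scalar f -> linear (fun x => f x *: w).
Proof. by move=> fL a x y; rewrite fL scalerDl scalerA. Qed.

Lemma linPair (f : V -> W) (g : V -> X) :
  linear f -> linear g -> linear (fun x => (f x, g x) : W * X).
Proof. by move=> fL gL a x y; rewrite fL gL. Qed.

Lemma linBl (m : {bilinear W -> X -> Y}) f w :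
  linear f -> linear (fun x => m (f x) w).
Proof. by move=> fL a x y; rewrite fL linearPl. Qed.

Lemma linBr (m : {bilinear X -> W -> Y}) f w :
  linear f -> linear (fun x => m w (f x)).
Proof. by move=> fL a x y; rewrite fL linearPr. Qed.

End LinearClosure.

Section Smirnov.
Variables (F : fieldType) (C : cayley F).

Local Notation mul := (nalg_mul C).
Local Notation one := (cay_one C).
Local Notation n := (polar (@cay_norm F C)).

Lemma polarC x y : n x y = n y x.
Proof. by rewrite /polar [y + x]addrC addrAC. Qed.

Lemma polarPl y a x x' : n (a *: x + x') y = a * n x y + n x' y.
Proof. exact: (cay_quadratic C).2. Qed.

Lemma polarPr y a x x' : n y (a *: x + x') = a * n y x + n y x'.
Proof. by rewrite !(polarC y) polarPl. Qed.

Lemma polarDl y x x' : n (x + x') y = n x y + n x' y.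
Proof. by have := polarPl y 1 x x'; rewrite scale1r mul1r. Qed.

Lemma polarDr y x x' : n y (x + x') = n y x + n y x'.
Proof. by rewrite !(polarC y) polarDl. Qed.

Lemma normD x y : cay_norm (x + y) = cay_norm x + cay_norm y + n x y.
Proof. by rewrite /polar; ring. Qed.

Definition cay_conj (x : C) : C := n x one *: one - x.

Lemma cay_conj_linear : linear cay_conj.
Proof.
move=> a x y; rewrite /cay_conj polarPl scalerDl scalerBr scalerA opprD addrACA.
by [].
Qed.

HB.instance Definition _ := GRing.isLinear.Build F C C _ cay_conj cay_conj_linear.

Definition skew : {vspace C} := lker (linfun (fun x => cay_conj x + x)).

Lemma mem_skew x : (x \in skew) = (cay_conj x == - x).
Proof.
rewrite /skew memv_ker -addr_eq0.
have L : linear (fun x => cay_conj x + x).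
  by move=> a u v; rewrite linearP scalerDr addrACA.
pose g : {linear C -> C} := HB.pack (fun x => cay_conj x + x)
  (GRing.isLinear.Build F C C _ (fun x => cay_conj x + x) L).
by rewrite -[(fun x => cay_conj x + x)]/(g : C -> C) lfunE.
Qed.

Local Notation S := (subvs_of skew).

Lemma trace_mulC x y : n (mul x y) one = n (mul y x) one.
Proof.
have nMl a b c : n (mul a c) (mul b c) = n a b * cay_norm c.
  by rewrite {1}/polar -linearDl !cay_normM /polar !mulrBl.
have norm1M u v : n u one * n v one = n (mul u v) one + n u v.
  have e1 := nMl u one v; have e2 := nMl u one one.
  have := nMl u one (v + one); rewrite !linearDr !cay_mul1 normD.
  move: e1; rewrite !cay_mulr1 !cay_mul1 !polarDr !polarDl => ->.
  move: e2; rewrite !cay_mulr1 => e2 e.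
  have -> : n u one * n v one = n u one * (cay_norm v + cay_norm one + n v one)
     - n u one * cay_norm v - n u one * cay_norm one by ring.
  by rewrite -e -e2; ring.
by apply: (addIr (n x y)); rewrite -norm1M [n x y]polarC -norm1M mulrC.
Qed.


Lemma mulB_skew x y : mul x y - mul y x \in skew.
Proof.
rewrite mem_skew /cay_conj [mul x y - _]addrC -scaleN1r polarPl trace_mulC.
rewrite mulN1r addNr.
by rewrite scale0r sub0r.
Qed.

Let vsvalP a (s t : S) : vsval (a *: s + t) = a *: vsval s + vsval t.
Proof. exact: linearP. Qed.

Definition comm (s t : S) : S :=
  vsproj skew (mul (vsval s) (vsval t) - mul (vsval t) (vsval s)).

Lemma val_comm s t :
  vsval (comm s t) = mul (vsval s) (vsval t) - mul (vsval t) (vsval s).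
Proof. by rewrite /comm vsprojK ?mulB_skew. Qed.

Lemma comm_bilinear : bilinear_for *:%R *:%R comm.
Proof.
split=> [t|s] a x y; apply: subvs_inj; rewrite vsvalP !val_comm vsvalP.
  by rewrite linearPl linearPr scalerBr opprD addrACA.
by rewrite linearPl linearPr scalerBr opprD addrACA.
Qed.

HB.instance Definition _ :=
  bilinear_isBilinear.Build F S S S *:%R *:%R comm comm_bilinear.

Lemma commC s t : comm s t = - comm t s.
Proof. by apply: subvs_inj; rewrite linearN /= !val_comm opprB. Qed.

Definition nS (s t : S) : F := n (vsval s) (vsval t).

Lemma nSC s t : nS s t = nS t s. Proof. exact: polarC. Qed.

Lemma nS_bilinear : bilinear_for *%R *%R nS.
Proof.
by split=> [t|s] a x y; rewrite /nS vsvalP ?polarPl ?polarPr.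
Qed.

HB.instance Definition _ :=
  bilinear_isBilinear.Build F S S F *%R *%R nS nS_bilinear.

Definition symrel : {vspace tensor S S} :=
  <<[seq tens (bas p.1) (bas p.2) - tens (bas p.2) (bas p.1)
      | p : 'I_(\dim {:S}) * 'I_(\dim {:S})]>>%VS.

Lemma symrelP (s t : S) : tens s t - tens t s \in symrel.
Proof.
have -> : tens s t - tens t s = \sum_i \sum_j (crd s i * crd t j) *:
    (tens (bas i) (bas j) - tens (bas j) (bas i)).
  have tE (u v : S) : tens u v =
      \sum_i \sum_j (crd u i * crd v j) *: tens (bas i) (bas j).
    rewrite [LHS]tens_sum; apply: eq_bigr => i _; apply: eq_bigr => j _.
    by rewrite mxE.
  rewrite (tE s t) (tE t s) [X in _ - X]exchange_big -sumrB.
  apply: eq_bigr => i _; rewrite -sumrB; apply: eq_bigr => j _.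
  by rewrite scalerBr [crd t j * _]mulrC.
apply: rpred_sum => i _; apply: rpred_sum => j _; apply: rpredZ.
by apply: memv_span; apply/mapP; exists (i, j); rewrite ?mem_enum.
Qed.

Definition symsq : vectType F := quot symrel.
Local Notation H := symsq.

Definition times (s t : S) : H := qproj symrel (tens s t).

Local Notation "s '\x' t" := (times s t) (at level 40, left associativity).

Lemma times_bilinear : bilinear_for *:%R *:%R times.
Proof.
by split=> [t|s] a x y; rewrite /times ?linearPl ?linearPr linearP.
Qed.

HB.instance Definition _ :=
  bilinear_isBilinear.Build F S S H *:%R *:%R times times_bilinear.

Lemma timesC s t : s \x t = t \x s.
Proof.
by apply/eqP; rewrite -subr_eq0 -linearB /= qproj_eq0 symrelP.
Qed.

(* The linear map H -> U induced by a symmetric bilinear map S x S -> U; its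
   value at q is computed on the representative [qrepr q] in S (x) S. *)
Definition hlift (U : lmodType F) (f : S -> S -> U) (q : H) : U :=
  tlift f (qrepr q).

Lemma hlift_linear (U : lmodType F) (f : S -> S -> U) : linear (hlift f).
Proof. by move=> a p q; rewrite /hlift !linearP. Qed.

HB.instance Definition _ (U : lmodType F) (f : S -> S -> U) :=
  GRing.isLinear.Build F H U _ (hlift f) (hlift_linear f).

Lemma hlift_times (U : vectType F) (f : S -> S -> U) s t :
    bilinear_for *:%R *:%R f -> (forall u v, f u v = f v u) ->
  hlift f (s \x t) = f s t.
Proof.
move=> fL fC; rewrite -(tlift_tens s t fL); apply/eqP.
rewrite -subr_eq0 /hlift -linearB /=.
have sub : (symrel <= lker (linfun (tlift f)))%VS.
  apply/span_subvP => _ /mapP[[i j] _ ->].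
  by rewrite memv_ker lfunE /= linearB /= !tlift_tens // fC subrr.
have /(subvP sub) := qreprB symrel (tens s t).
by rewrite memv_ker lfunE.
Qed.

Lemma hliftP (U : lmodType F) a (f g h : S -> S -> U) q :
    (forall u v, f u v = a *: g u v + h u v) ->
  hlift f q = a *: hlift g q + hlift h q.
Proof. exact: tliftP. Qed.

(* The four products below are determined by their values on the generators
   s1 \x s2 of H, given in [odotSH_times], [odotHH_times], [bracketSH_times] and
   [bracketHH_times]. *)
Definition odotSH (s : S) (q : H) : S :=
  hlift (fun s1 s2 =>
    - (nS s1 s2 *: s) - 2^-1 *: (nS s s1 *: s2 + nS s s2 *: s1)) q.

Definition odotHH (p q : H) : H :=
  hlift (fun s1 s2 => hlift (fun s3 s4 =>
    4^-1 *: (comm s1 s3 \x comm s2 s4 + comm s1 s4 \x comm s2 s3)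
    - nS s1 s2 *: (s3 \x s4) - nS s3 s4 *: (s1 \x s2)) q) p.

Definition bracketSH (s : S) (q : H) : H :=
  hlift (fun s1 s2 => comm s s1 \x s2 + s1 \x comm s s2) q.

Definition bracketHH (p q : H) : S :=
  hlift (fun s1 s2 => hlift (fun s3 s4 =>
    - (2^-1 *: (nS s1 s3 *: comm s2 s4 + nS s1 s4 *: comm s2 s3
                + nS s2 s3 *: comm s1 s4 + nS s2 s4 *: comm s1 s3))) q) p.

Local Notation T := (H * S)%type.

Definition odot (x y : T) : T :=
  (odotHH x.1 y.1 + x.2 \x y.2, odotSH x.2 y.1 + odotSH y.2 x.1).

Definition bracket (x y : T) : T :=
  (bracketSH x.2 y.1 - bracketSH y.2 x.1, bracketHH x.1 y.1 + comm x.2 y.2).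

Definition smirnov_mul (x y : T) : T := odot x y + 2^-1 *: bracket x y.

Definition smirnov_inv (x : T) : T := (x.1, - x.2).

Let lin_id (V : lmodType F) : linear (@id V). Proof. by []. Qed.

Let scal_nl (V : lmodType F) (f : V -> S) t :
  linear f -> scalar (fun x => nS (f x) t).
Proof. by move=> fL a x y; rewrite fL linearPl. Qed.

Let scal_nr (V : lmodType F) (f : V -> S) t :
  linear f -> scalar (fun x => nS t (f x)).
Proof. by move=> fL a x y; rewrite fL linearPr. Qed.

Let lin_hlift (V U : lmodType F) (f : V -> S -> S -> U) q :
  (forall s t, linear (fun x => f x s t)) -> linear (fun x => hlift (f x) q).
Proof. by move=> fL a x y; apply: hliftP => s t; apply: fL. Qed.

Ltac lin_step :=
  match goal with |- GRing.linear_for _ ?f => lazymatch f with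
  | GRing.scale _ => apply: (linZ _ (@lin_id _))
  | comm _ => apply: (linBr comm _ (@lin_id _))
  | times _ => apply: (linBr times _ (@lin_id _))
  | fun x => hlift _ _ => apply: lin_hlift => ? ?
  | fun x => GRing.add _ _ => apply: linD
  | fun x => Algebra.add _ _ => apply: linD
  | fun x => GRing.opp _ => apply: linN
  | fun x => Algebra.opp _ => apply: linN
  | fun x => GRing.scale _ _ => first
      [ apply: linZ
      | by apply: linZl; apply: scal_nl; exact: lin_id
      | by apply: linZl; apply: scal_nr; exact: lin_id ]
  | fun x => comm _ _ => first [ apply: (linBr comm) | apply: (linBl comm) ]
  | fun x => times _ _ => first [ apply: (linBr times) | apply: (linBl times) ]
  | _ => exact: lin_id
  end end.
Ltac lin := rewrite /=; repeat lin_step.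

Lemma odotSH_bilinear : bilinear_for *:%R *:%R odotSH.
Proof. by split=> [q|s]; [rewrite /odotSH; lin | exact: hlift_linear]. Qed.

Lemma odotHH_bilinear : bilinear_for *:%R *:%R odotHH.
Proof.
split=> [q|p]; first exact: hlift_linear.
by apply: lin_hlift => s t; exact: hlift_linear.
Qed.

Lemma bracketSH_bilinear : bilinear_for *:%R *:%R bracketSH.
Proof. by split=> [q|s]; [rewrite /bracketSH; lin | exact: hlift_linear]. Qed.

Lemma bracketHH_bilinear : bilinear_for *:%R *:%R bracketHH.
Proof.
split=> [q|p]; first exact: hlift_linear.
by apply: lin_hlift => s t; exact: hlift_linear.
Qed.

HB.instance Definition _ :=
  bilinear_isBilinear.Build F S H S *:%R *:%R odotSH odotSH_bilinear.
HB.instance Definition _ :=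
  bilinear_isBilinear.Build F H H H *:%R *:%R odotHH odotHH_bilinear.
HB.instance Definition _ :=
  bilinear_isBilinear.Build F S H H *:%R *:%R bracketSH bracketSH_bilinear.
HB.instance Definition _ :=
  bilinear_isBilinear.Build F H H S *:%R *:%R bracketHH bracketHH_bilinear.

Lemma odotSH_times s s1 s2 : odotSH s (s1 \x s2) =
  - (nS s1 s2 *: s) - 2^-1 *: (nS s s1 *: s2 + nS s s2 *: s1).
Proof.
rewrite /odotSH hlift_times // => [|u v]; first by split=> ?; lin.
by rewrite nSC [_ *: _ + _]addrC.
Qed.

Lemma odotHH_times s1 s2 s3 s4 : odotHH (s1 \x s2) (s3 \x s4) =
  4^-1 *: (comm s1 s3 \x comm s2 s4 + comm s1 s4 \x comm s2 s3)
  - nS s1 s2 *: (s3 \x s4) - nS s3 s4 *: (s1 \x s2).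
Proof.
pose f s1 s2 s3 s4 :=
  4^-1 *: (comm s1 s3 \x comm s2 s4 + comm s1 s4 \x comm s2 s3)
  - nS s1 s2 *: (s3 \x s4) - nS s3 s4 *: (s1 \x s2).
have inner u v : hlift (f u v) (s3 \x s4) = f u v s3 s4.
  rewrite hlift_times // => [|w z]; first by split=> ?; rewrite /f; lin.
  by rewrite /f (timesC w z) (nSC w z) [X in 4^-1 *: X]addrC.
rewrite /odotHH hlift_times => [|| u v]; first exact: inner.
  have L1 v : linear (fun u => f u v s3 s4) by rewrite /f; lin.
  have L2 u : linear (fun v => f u v s3 s4) by rewrite /f; lin.
  by split=> u a x y; rewrite !inner ?L1 ?L2.
by rewrite !inner /f (timesC u v) (nSC u v) [X in 4^-1 *: X]addrC
  (timesC (comm u s4)) (timesC (comm u s3)).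
Qed.

Lemma bracketSH_times s s1 s2 :
  bracketSH s (s1 \x s2) = comm s s1 \x s2 + s1 \x comm s s2.
Proof.
rewrite /bracketSH hlift_times // => [|u v]; first by split=> ?; lin.
by rewrite addrC (timesC u) (timesC _ v).
Qed.

Let swap2 (a b c d : S) : a + b + c + d = b + a + d + c.
Proof. by rewrite (addrC a) -!addrA (addrC c). Qed.

Let swap4 (a b c d : S) : a + b + c + d = c + d + a + b.
Proof. by rewrite -addrA addrC addrA. Qed.

Lemma bracketHH_times s1 s2 s3 s4 : bracketHH (s1 \x s2) (s3 \x s4) =
  - (2^-1 *: (nS s1 s3 *: comm s2 s4 + nS s1 s4 *: comm s2 s3
              + nS s2 s3 *: comm s1 s4 + nS s2 s4 *: comm s1 s3)).
Proof.
pose f s1 s2 s3 s4 :=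
  - (2^-1 *: (nS s1 s3 *: comm s2 s4 + nS s1 s4 *: comm s2 s3
              + nS s2 s3 *: comm s1 s4 + nS s2 s4 *: comm s1 s3)).
have inner u v : hlift (f u v) (s3 \x s4) = f u v s3 s4.
  rewrite hlift_times // => [|w z]; first by split=> ?; rewrite /f; lin.
  by rewrite /f swap2.
rewrite /bracketHH hlift_times => [|| u v]; first exact: inner.
  have L1 v : linear (fun u => f u v s3 s4) by rewrite /f; lin.
  have L2 u : linear (fun v => f u v s3 s4) by rewrite /f; lin.
  by split=> u a x y; rewrite !inner ?L1 ?L2.
by rewrite !inner /f swap4.
Qed.

Let lin1 : linear (fun x : T => x.1). Proof. by []. Qed.
Let lin2 : linear (fun x : T => x.2). Proof. by []. Qed.

Lemma odot_bilinear : bilinear_for *:%R *:%R odot.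
Proof.
split=> z; apply: linPair; apply: linD.
- exact: (linBl odotHH z.1 lin1).
- exact: (linBl times z.2 lin2).
- exact: (linBl odotSH z.1 lin2).
- exact: (linBr odotSH z.2 lin1).
- exact: (linBr odotHH z.1 lin1).
- exact: (linBr times z.2 lin2).
- exact: (linBr odotSH z.2 lin1).
- exact: (linBl odotSH z.1 lin2).
Qed.

Lemma bracket_bilinear : bilinear_for *:%R *:%R bracket.
Proof.
split=> z; apply: linPair; apply: linD.
- exact: (linBl bracketSH z.1 lin2).
- exact: (linN (linBr bracketSH z.2 lin1)).
- exact: (linBl bracketHH z.1 lin1).
- exact: (linBl comm z.2 lin2).
- exact: (linBr bracketSH z.2 lin1).
- exact: (linN (linBl bracketSH z.1 lin2)).
- exact: (linBr bracketHH z.1 lin1).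
- exact: (linBr comm z.2 lin2).
Qed.

Lemma smirnov_mul_bilinear : bilinear_for *:%R *:%R smirnov_mul.
Proof.
split=> p; apply: linD; try apply: linZ.
- exact: odot_bilinear.1.
- exact: bracket_bilinear.1.
- exact: odot_bilinear.2.
- exact: bracket_bilinear.2.
Qed.

HB.instance Definition _ :=
  bilinear_isBilinear.Build F T T T *:%R *:%R smirnov_mul smirnov_mul_bilinear.

Lemma smirnov_inv_linear : linear smirnov_inv.
Proof. by apply: linPair; [exact: lin1 | apply: linN; exact: lin2]. Qed.

HB.instance Definition _ :=
  GRing.isLinear.Build F T T _ smirnov_inv smirnov_inv_linear.

Definition smirnov : nalg F := @NAlg F T smirnov_mul.

Definition smirnov_involution : 'End(smirnov) := linfun smirnov_inv.

Lemma smirnov_involutionE (q : H) (s : S) :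
  smirnov_involution (q, s) = (q, - s) :> T.
Proof. exact: lfunE. Qed.

Lemma smirnov_mulE (p q : H) (s t : S) :
  nalg_mul smirnov (p, s) (q, t) =
    odot (p, s) (q, t) + 2^-1 *: bracket (p, s) (q, t).
Proof. by []. Qed.

Lemma symsq_sum (q : H) : exists c : 'I_(\dim {:S}) -> 'I_(\dim {:S}) -> F,
  q = \sum_i \sum_j c i j *: (bas i \x bas j).
Proof.
exists (fun i j => qrepr q i j).
rewrite -[LHS]qreprK [qrepr q in LHS]tens_sum linear_sum.
apply: eq_bigr => i _; rewrite linear_sum; apply: eq_bigr => j _.
by rewrite linearZ.
Qed.

Lemma symsq_ind (U : lmodType F) (f g : H -> U) : linear f -> linear g ->
  (forall s t, f (s \x t) = g (s \x t)) -> f =1 g.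
Proof.
move=> fL gL fg q; have [c ->] := symsq_sum q.
pose f' : {linear H -> U} := HB.pack f (GRing.isLinear.Build F H U _ f fL).
pose g' : {linear H -> U} := HB.pack g (GRing.isLinear.Build F H U _ g gL).
rewrite -[f]/(f' : H -> U) -[g]/(g' : H -> U) !linear_sum.
apply: eq_bigr => i _; rewrite !linear_sum; apply: eq_bigr => j _.
by rewrite !linearZ /= fg.
Qed.

Lemma odotHHC p q : odotHH p q = odotHH q p.
Proof.
move: p; apply: symsq_ind => [||s1 s2].
- exact: odotHH_bilinear.1.
- exact: odotHH_bilinear.2.
move: q; apply: symsq_ind => [||s3 s4].
- exact: odotHH_bilinear.2.
- exact: odotHH_bilinear.1.
rewrite !odotHH_times.
rewrite (commC s3) (commC s4 s2) (commC s3 s2) (commC s4 s1).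
rewrite !linearNl !linearNr /= !opprK (timesC (comm s2 s3)).
by rewrite [RHS]addrAC.
Qed.

Lemma bracketHHC p q : bracketHH p q = - bracketHH q p.
Proof.
move: p; apply: symsq_ind => [||s1 s2].
- exact: bracketHH_bilinear.1.
- exact: (linN (bracketHH_bilinear.2 _)).
move: q; apply: symsq_ind => [||s3 s4].
- exact: bracketHH_bilinear.2.
- exact: (linN (bracketHH_bilinear.1 _)).
rewrite !bracketHH_times opprK.
rewrite (commC s3 s1) (commC s4 s2) (commC s3 s2) (commC s4 s1) !scalerN.
rewrite -!opprD scalerN (nSC s3 s1) (nSC s4 s2) (nSC s3 s2) (nSC s4 s1).
by congr (- (_ *: (_ + _))); rewrite addrAC.
Qed.

Lemma odotC x y : odot x y = odot y x.
Proof. by rewrite /odot odotHHC timesC addrC [odotSH _ _ + _]addrC. Qed.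

Lemma bracketC x y : bracket x y = - bracket y x.
Proof.
by congr pair; rewrite /= ?opprB // opprD -bracketHHC -commC.
Qed.

Lemma smirnov_invK : involutive smirnov_inv.
Proof. by case=> q s; rewrite /smirnov_inv /= opprK. Qed.

Lemma smirnov_invM x y :
  smirnov_inv (smirnov_mul x y) = smirnov_mul (smirnov_inv y) (smirnov_inv x).
Proof.
rewrite /smirnov_mul bracketC odotC.
congr pair; rewrite /= !(linearNl, linearNr) /= ?opprK.
  by rewrite opprB [- _ + _]addrC.
by rewrite scalerN opprD opprK opprD.
Qed.

End Smirnov.

(* Main.v *)
From HB Require Import structures.
From mathcomp Require Import all_boot all_order all_algebra.
From mathcomp Require Import sesquilinear.
From mathcomp Require Import boolp ring.
Require Import Defs.

(* Both functors are identified with the functor of R-linear bijections psi of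
   S_R preserving the commutator and the polar form of the norm.

   If f is an automorphism of C_R and s is skew, write f(s) = a1 + s' with s'
   skew.  Since s^2 is a scalar, so is f(s)^2, whence a s' = 0 and
   a f(s) = a^2 1; applying the inverse of f gives a s = 0.  For s in a basis of
   S this forces a = 0, and as a is linear in s, f preserves S_R.  On S the
   product is 1/2 ([s,t] - n(s,t) 1), so f restricts to such a psi, and
   conversely psi extends by 1 |-> 1.

   An automorphism of T(C)_R commuting with the involution preserves H_R and
   S_R; its restriction psi to S_R determines it because S generates T(C), and
   psi preserves the commutator.  Comparing psi(s o (s1 x s2)) with
   psi(s) o (psi(s1) x psi(s2)), the difference d of the forms n(psi(.),psi(.))
   and n satisfies
     d(s1,s2) s + 1/2 (d(s,s1) s2 + d(s,s2) s1) = 0,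
   and for basis vectors with s different from s1 and s2 this gives
   d(s1,s2) = 0.  Conversely psi extends by s x t |-> psi(s) x psi(t), since the
   structure constants of T(C) only involve the commutator and n. *)

Set Implicit Arguments.
Unset Strict Implicit.
Unset Printing Implicit Defensive.

Import GRing.Theory.
Local Open Scope ring_scope.

(** * Preliminaries on linear maps, indices and group functors *)

Section LinearClosure.
Variables (R : comPzRingType) (U V W : lmodType R).

Lemma linear_id : linear (@id V). Proof. by []. Qed.

Lemma linear_add (f g : V -> W) :
  linear f -> linear g -> linear (fun x => f x + g x).
Proof. by move=> fL gL a x y; rewrite fL gL scalerDr addrACA. Qed.

Lemma linear_opp (f : V -> W) : linear f -> linear (fun x => - f x).
Proof. by move=> fL a x y; rewrite fL opprD scalerN. Qed.

Lemma linear_scale c (f : V -> W) : linear f -> linear (fun x => c *: f x).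
Proof. by move=> fL a x y; rewrite fL scalerDr !scalerA mulrC. Qed.

Lemma linear_scalel (f : V -> R) (w : W) :
  scalar f -> linear (fun x => f x *: w).
Proof. by move=> fL a x y; rewrite fL scalerDl scalerA. Qed.

Lemma linear_comp (g : V -> W) (f : U -> V) :
  linear g -> linear f -> linear (fun x => g (f x)).
Proof. by move=> gL fL a x y; rewrite fL gL. Qed.

End LinearClosure.

Lemma linear_morphs (R : comPzRingType) (U V : lmodType R) (f : U -> V) :
  linear f -> [/\ {morph f : x y / x + y}, {morph f : x / - x},
                  f 0 = 0 & forall a, {morph f : x / a *: x}].
Proof.
move=> fL.
pose f' : {linear U -> V} := HB.pack f (GRing.isLinear.Build R U V _ f fL).
split=> [x y|x||a x].
- exact: (linearD f').
- exact: (linearN f').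
- exact: (linear0 f').
- exact: (linearZ_LR f').
Qed.

Lemma bijective_linear (R : comPzRingType) (U V : lmodType R) (f : U -> V) g :
  linear f -> cancel f g -> cancel g f -> linear g.
Proof. by move=> fL fK gK a x y; apply: (can_inj fK); rewrite fL !gK. Qed.

Lemma ord_avoid2 m (i j : 'I_m) : (2 < m)%N -> exists2 k, k != i & k != j.
Proof.
move=> m2; have /subsetPn[k _] : ~~ ([set: 'I_m] \subset [set i; j]).
  apply/negP => /subset_leq_card; rewrite cardsT card_ord leqNgt => /negP.
  by apply; rewrite (leq_ltn_trans _ m2) // cards2; case: (_ == _).
by rewrite !inE negb_or => /andP[ki kj]; exists k.
Qed.

(** The pointwise inverses are automatically multiplicative and natural: both properties can be
    checked after applying the injective map [Phi R]. *)
Lemma gf_isomorphic_bij (F : fieldType) (G H : groupFunctor F)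
    (Phi : gfHom G H) : (forall R, bijective (Phi R)) -> gf_isomorphic G H.
Proof.
move=> Phi_bij.
have inv R : exists g : H R -> G R, cancel (Phi R) g /\ cancel g (Phi R).
  by case: (Phi_bij R) => g; exists g.
pose psi R := sval (cid (inv R)).
have psiP R : cancel (Phi R) (psi R) /\ cancel (psi R) (Phi R).
  exact: svalP (cid (inv R)).
have psiM R : {morph psi R : x y / (x * y)%g}.
  move=> x y; apply: (can_inj (psiP R).1).
  by rewrite (psiP R).2 gmulfM !(psiP R).2.
pose Psi R : {multiplicative H R -> G R} :=
  HB.pack (psi R) (isMultiplicative.Build (H R) (G R) (psi R) (psiM R)).
have nat R S (f : commAlgHom R S) x :
    Psi S (gf_map H f x) = gf_map G f (Psi R x).
  apply: (can_inj (psiP S).1).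
  by rewrite gf_natural /= !(psiP _).2.
by exists Phi, (GfHom nat) => R; exact: psiP.
Qed.

(** * Extension of scalars *)

Section ExtensionTheory.
Variables (F : fieldType) (R : commAlg F).
Implicit Types U V W X : vectType F.

Section ExtBil.
Variables (U V W : vectType F) (m : U -> V -> W).
Implicit Types (x : ext R U) (y : ext R V) (a : R).

HB.instance Definition _ x := GRing.isLinear.Build R (ext R V) (ext R W) _
  (ext_bil R m x) (ext_bil_linearr m x).

Let bil_left y : {linear ext R U -> ext R W} := HB.pack (ext_bil R m ^~ y)
  (GRing.isLinear.Build R (ext R U) (ext R W) _ (ext_bil R m ^~ y)
     (ext_bil_linearl m y)).

Lemma ext_bilDl x x' y :
  ext_bil R m (x + x') y = ext_bil R m x y + ext_bil R m x' y.
Proof. exact: (linearD (bil_left y)). Qed.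

Lemma ext_bil_suml I (r : seq I) (x : I -> ext R U) y :
  ext_bil R m (\sum_(i <- r) x i) y = \sum_(i <- r) ext_bil R m (x i) y.
Proof. exact: (linear_sum (bil_left y)). Qed.

Lemma ext_bilZl a x y : ext_bil R m (a *: x) y = a *: ext_bil R m x y.
Proof. exact: (linearZ_LR (bil_left y)). Qed.

End ExtBil.

Lemma ext_inD V : {morph @ext_in F R V : u v / u + v}.
Proof. by move=> u v; rewrite -[u in LHS]scale1r ext_inP rmorph1 scale1r. Qed.

Lemma ext_in0 V : ext_in R (0 : V) = 0.
Proof. by apply: (addrI (ext_in R 0)); rewrite -ext_inD !addr0. Qed.

Lemma ext_inZ V a (v : V) : ext_in R (a *: v) = calg_in R a *: ext_in R v.
Proof. by rewrite -[a *: v]addr0 ext_inP ext_in0 addr0. Qed.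

Lemma ext_inN V (v : V) : ext_in R (- v) = - ext_in R v.
Proof. by rewrite -scaleN1r ext_inZ rmorphN1 scaleN1r. Qed.

Lemma ext_lin_comp U V W (f : {linear V -> W}) (g : U -> V) x :
  ext_lin R f (ext_lin R g x) = ext_lin R (fun u => f (g u)) x.
Proof.
rewrite {2}/ext_lin /ext_lift linear_sum; apply: eq_bigr => i _.
by rewrite linearZ /= ext_lin_in.
Qed.

Lemma ext_lin_id V : ext_lin R (@id V) =1 id.
Proof. by move=> x; rewrite [RHS]ext_sum. Qed.

Lemma ext_lin0 U V x : ext_lin R (fun _ : U => 0 : V) x = 0.
Proof.
by rewrite /ext_lin /ext_lift big1 // => i _; rewrite ext_in0 scaler0.
Qed.

(** The extension of a linear form takes its values in [R] itself, rather than in row vectors over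
    [R], so that it can serve as a coefficient. *)
Definition ext_form V (l : V -> F) (x : ext R V) : R :=
  \sum_i x 0 i * calg_in R (l (bas i)).

Lemma ext_form_scalar V (l : V -> F) : scalar (ext_form l).
Proof.
move=> a x y; rewrite /ext_form mulr_sumr -big_split; apply: eq_bigr => i _.
by rewrite !mxE mulrDl mulrA.
Qed.

Lemma ext_form_in V (l : V -> F) v :
  scalar l -> ext_form l (ext_in R v) = calg_in R (l v).
Proof.
move=> lL.
pose l' : {scalar V} := HB.pack l (GRing.isLinear.Build F V F _ l lL).
rewrite {2}[v]crd_sum -[l]/(l' : _ -> _) linear_sum rmorph_sum.
by apply: eq_bigr => i _; rewrite linearZ /= rmorphM mxE.
Qed.

Definition ext_bilform U V (b : U -> V -> F) (x : ext R U) (y : ext R V) : R :=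
  \sum_i x 0 i * ext_form (b (bas i)) y.

Lemma ext_bilform_scalarl U V (b : U -> V -> F) y : scalar (ext_bilform b ^~ y).
Proof.
move=> a x x'; rewrite /ext_bilform mulr_sumr -big_split.
by apply: eq_bigr => i _; rewrite !mxE mulrDl mulrA.
Qed.

Lemma ext_bilform_scalarr U V (b : U -> V -> F) x : scalar (ext_bilform b x).
Proof.
move=> a y y'; rewrite /ext_bilform mulr_sumr -big_split.
by apply: eq_bigr => i _; rewrite ext_form_scalar mulrDr mulrCA.
Qed.

Lemma ext_bilform_in U V (b : U -> V -> F) u v :
  (forall u, scalar (b u)) -> (forall v, scalar (b ^~ v)) ->
  ext_bilform b (ext_in R u) (ext_in R v) = calg_in R (b u v).
Proof.
move=> br bl; rewrite -(ext_form_in _ (bl v)); apply: eq_bigr => i _.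
by rewrite ext_form_in.
Qed.

End ExtensionTheory.

Arguments ext_form {F} R {V} l x.
Arguments ext_bilform {F} R {U V} b x y.

(** Proves linearity by descending through sums, opposites, scalings and extended linear or bilinear
    maps, using linearity hypotheses of the context. It discharges the side conditions of
    [ext_lift_unique]. *)
Ltac linearity :=
  rewrite /=; repeat (
  match goal with
  | H : linear ?f |- GRing.linear_for _ ?f => exact: H
  | H : linear ?f |- GRing.linear_for _ (fun x => ?f _) =>
     apply: (linear_comp H)
  | |- GRing.linear_for _ ?f => lazymatch f with
  | GRing.scale _ => exact: (linear_scale _ (@linear_id _ _))
  | ext_bil _ _ _ => exact: ext_bil_linearr
  | ext_lin _ _ => exact: ext_lin_linear
  | fun x => GRing.add _ _ => apply: linear_add
  | fun x => Algebra.add _ _ => apply: linear_add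
  | fun x => GRing.opp _ => apply: linear_opp
  | fun x => Algebra.opp _ => apply: linear_opp
  | fun x => GRing.scale _ _ => first
      [ apply: linear_scale
      | apply: linear_scalel; exact: ext_bilform_scalarr
      | apply: linear_scalel; exact: ext_bilform_scalarl ]
  | fun x => ext_lin _ _ _ => apply: (linear_comp (@ext_lin_linear _ _ _ _ _))
  | fun x => ext_bil _ _ _ _ => first
      [ apply: (linear_comp (@ext_bil_linearr _ _ _ _ _ _ _))
      | apply: (linear_comp (@ext_bil_linearl _ _ _ _ _ _ _)) ]
  | _ => exact: linear_id
  end end).

Lemma ext_scalar_eq0 (F : fieldType) (R : commAlg F) (V : vectType F)
    (l : ext R V -> R) :
  scalar l -> (forall i, l (ext_in R (bas i)) = 0) -> forall x, l x = 0.
Proof.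
move=> lL l0 x.
pose l' : {scalar ext R V} :=
  HB.pack l (GRing.isLinear.Build R (ext R V) R _ l lL).
rewrite [x]ext_sum -[l]/(l' : _ -> _) linear_sum big1 // => i _.
by rewrite linearZ /= l0 mulr0.
Qed.

(** * Composition algebras *)

Section Composition.
Variables (F : fieldType) (C : cayley F).
Hypothesis char2 : 2%N \notin [pchar F].
Local Notation mul := (nalg_mul C).
Local Notation one := (cay_one C).
Local Notation norm := (@cay_norm F C).
Local Notation n := (polar norm).
Local Notation S := (subvs_of (skew C)).

Lemma two_neq0 : 2%:R != 0 :> F.
Proof. by apply: contra char2 => p; rewrite inE p. Qed.

(** By multiplicativity the norm of 1 is idempotent. Were it 0, the norm would vanish identically,
    and nondegeneracy would force dimension 0 instead of 8. *)
Lemma cay_norm_one : norm one = 1.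
Proof.
have /eqP := cay_normM one one; rewrite cay_mul1 -subr_eq0 -{1}[norm one]mulr1.
rewrite -mulrBr mulf_eq0 subr_eq0 => /orP[/eqP n0|/eqP<-//].
have norm0 x : norm x = 0 by rewrite -[x](cay_mulr1 x) cay_normM n0 mulr0.
have V0 : (fullv : {vspace C}) = 0%VS.
  apply/eqP; rewrite -subv0; apply/subvP => x _; rewrite memv0.
  by apply/eqP/(@cay_nondegenerate F C) => y; rewrite /polar !norm0 !subr0.
by have := cay_dim C; rewrite V0 dimv0.
Qed.

Lemma polar_one : n one one = 2%:R.
Proof.
have -> : n one one = norm (2%:R *: one) - norm one - norm one.
  by rewrite scaler_nat.
by rewrite (cay_quadratic C).1 cay_norm_one; ring.
Qed.

Lemma cay_one_neq0 : one != 0.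
Proof.
apply/eqP => one0; have := cay_norm_one; rewrite one0 -(scale0r one).
by rewrite (cay_quadratic C).1 expr0n mul0r => /esym/eqP; rewrite oner_eq0.
Qed.

Lemma skew_trace x : (x \in skew C) = (n x one == 0).
Proof.
rewrite mem_skew /cay_conj -subr_eq0 opprK subrK scaler_eq0.
by rewrite (negbTE cay_one_neq0) orbF.
Qed.

Lemma cay_polarMl x a b : n (mul x a) (mul x b) = norm x * n a b.
Proof. by rewrite {1}/polar -linearDr !cay_normM /polar !mulrBr. Qed.

(** Expand n((x+1)a, (x+1)b) = n(x+1) n(a,b), where n(x+1) = n(x) + 1 because n(x,1) = 0; the cross
    terms must cancel. *)
Lemma skew_adjoint x a b : x \in skew C -> n (mul x a) b = - n a (mul x b).
Proof.
rewrite skew_trace => /eqP tx.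
have := cay_polarMl (x + one) a b; rewrite !linearDl /= !cay_mul1.
rewrite !polarDl !polarDr !cay_polarMl normD tx cay_norm_one addr0 mulrDl mul1r.
move=> /(congr1 (fun z => z - norm x * n a b - n a b)).
have -> : norm x * n a b + n a b - norm x * n a b - n a b = 0 by ring.
by move=> e; apply/eqP; rewrite -addr_eq0 -e; apply/eqP; ring.
Qed.

Lemma polar_inj x y : (forall z, n x z = n y z) -> x = y.
Proof.
move=> xy; apply/eqP; rewrite -subr_eq0; apply/eqP.
apply: (@cay_nondegenerate F C) => z.
by rewrite addrC -scaleN1r polarPl xy; ring.
Qed.

Lemma polarZl a x y : n (a *: x) y = a * n x y.
Proof.
have n0 : n 0 y = 0 by apply: (addrI (n 0 y)); rewrite -polarDl !addr0.
by rewrite -[a *: x]addr0 polarPl n0 addr0.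
Qed.

(** Pairing with any z gives n(xx, z) = - n(x1, xz) = - n(x) n(1,z), and the polar form is
    nondegenerate. *)
Lemma skew_sqr x : x \in skew C -> mul x x = - norm x *: one.
Proof.
move=> xS; apply: polar_inj => z.
by rewrite skew_adjoint // -{1}[x]cay_mulr1 cay_polarMl polarZl; ring.
Qed.

(** Linearizing [skew_sqr] gives st + ts = - n(s,t) 1; adding st - ts and dividing by 2 gives the
    product. *)
Lemma mul_skew (s t : S) : mul (vsval s) (vsval t) =
  2^-1 *: (vsval (comm s t) - nS s t *: one).
Proof.
have anticomm : mul (vsval s) (vsval t) + mul (vsval t) (vsval s) =
    - nS s t *: one.
  have mulD x y : mul (x + y) (x + y) =
      mul x x + mul y y + (mul x y + mul y x).
    rewrite linearDl /= !linearDr /= -!addrA; congr (_ + _).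
    by rewrite addrA addrC.
  have := mulD (vsval s) (vsval t); rewrite -linearD !skew_sqr ?subvsP //.
  by rewrite linearD /= normD !opprD !scalerDl => /addrI<-.
apply: (scalerI two_neq0); rewrite scalerA divff ?two_neq0 // scale1r.
rewrite val_comm -scaleNr -anticomm scaler_nat mulr2n.
by rewrite addrACA addNr addr0.
Qed.

Fact imag_subproof x : x - (2^-1 * n x one) *: one \in skew C.
Proof.
rewrite skew_trace -scaleNr addrC polarDl polarZl polar_one.
by rewrite mulNr mulrAC mulVf ?two_neq0 // mul1r addNr.
Qed.

(** The projection onto S along F1; the scalar part is half the trace because 1 has trace 2. *)
Definition imag (x : C) : S := vsproj (skew C) (x - (2^-1 * n x one) *: one).

Lemma imag_linear : linear imag.
Proof.
move=> a x y; rewrite /imag -linearP /=; congr (vsproj _ _).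
rewrite polarPl mulrDr scalerDl scalerBr scalerA opprD addrACA.
by rewrite mulrCA.
Qed.

HB.instance Definition _ := GRing.isLinear.Build F C S _ imag imag_linear.

Lemma imagE x : x = (2^-1 * n x one) *: one + vsval (imag x).
Proof. by rewrite /imag vsprojK ?imag_subproof // addrC subrK. Qed.

Lemma imag_one : imag one = 0.
Proof.
by rewrite /imag polar_one mulVf ?two_neq0 // scale1r subrr linear0.
Qed.

Lemma imag_skew s : imag (vsval s) = s.
Proof.
rewrite /imag; have := subvsP s; rewrite skew_trace => /eqP->.
by rewrite mulr0 scale0r subr0 vsvalK.
Qed.

(** Rank-nullity: S is the kernel of x |-> n(x,1) 1, whose image lies in a line. *)
Lemma dim_skew : (7 <= \dim {:S})%N.
Proof.
have dS : \dim {:S} = \dim (skew C) by rewrite dimvf.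
have := limg_ker_dim (linfun (fun x : C => cay_conj x + x)) fullv.
rewrite capfv -/(skew C) cay_dim -dS => d8.
suff le1 : (\dim (linfun (fun x : C => cay_conj x + x) @: fullv) <= 1)%N.
  by rewrite -(leq_add2r 1) (leq_trans (eq_leq (esym d8))) // leq_add2l.
apply: leq_trans (dimvS _) (_ : \dim <[one]> <= 1)%N; last first.
  by rewrite dim_vline leq_b1.
apply/subvP => _ /memv_imgP[x _ ->].
have L : linear (fun x : C => cay_conj x + x).
  by move=> a u v; rewrite linearP scalerDr addrACA.
pose g : {linear C -> C} := HB.pack (fun x => cay_conj x + x)
  (GRing.isLinear.Build F C C _ (fun x => cay_conj x + x) L).
rewrite -[(fun x => cay_conj x + x)]/(g : C -> C) lfunE /= /cay_conj subrK.
by rewrite memvZ ?memv_line.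
Qed.

End Composition.

(** * Symmetries of the skew elements *)

Section SmirnovMaps.
Variables (F : fieldType) (C : cayley F).
Local Notation S := (subvs_of (skew C)).
Local Notation H := (symsq C).
Local Notation T := (smirnov C).

Definition skew_val (s : S) : C := vsval s.
Lemma skew_val_linear : linear skew_val.
Proof. by move=> a s t; exact: linearP. Qed.
HB.instance Definition _ :=
  GRing.isLinear.Build F S C _ skew_val skew_val_linear.

Definition inS (s : S) : T := (0, s).
Definition inH (q : H) : T := (q, 0).
Definition outS (x : T) : S := x.2.
Definition outH (x : T) : H := x.1.

Lemma inS_linear : linear inS.
Proof. by move=> a s t; congr pair; rewrite /= scaler0 addr0. Qed.
Lemma inH_linear : linear inH.
Proof. by move=> a s t; congr pair; rewrite /= scaler0 addr0. Qed.
Lemma outS_linear : linear outS. Proof. by []. Qed.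
Lemma outH_linear : linear outH. Proof. by []. Qed.
HB.instance Definition _ := GRing.isLinear.Build F S T _ inS inS_linear.
HB.instance Definition _ := GRing.isLinear.Build F H T _ inH inH_linear.
HB.instance Definition _ := GRing.isLinear.Build F T S _ outS outS_linear.
HB.instance Definition _ := GRing.isLinear.Build F T H _ outH outH_linear.

End SmirnovMaps.

Section Symmetries.
Variables (F : fieldType) (C : cayley F).
Hypothesis char2 : 2%N \notin [pchar F].
Local Notation S := (subvs_of (skew C)).
Local Notation H := (symsq C).
Local Notation T := (smirnov C).

Variable R : commAlg F.
Local Notation half := (calg_in R 2^-1).
Local Notation val_ := (ext_lin R (@skew_val F C)).
Local Notation imag_ := (ext_lin R (@imag F C)).
Local Notation one_ := (ext_in R (cay_one C)).
Local Notation trace_ :=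
  (ext_form R (fun x => polar (@cay_norm F C) x (cay_one C))).
Local Notation mulC_ := (ext_bil R (nalg_mul C)).
Local Notation mulT_ := (ext_bil R (nalg_mul T)).
Local Notation comm_ := (ext_bil R (@comm F C)).
Local Notation nS_ := (ext_bilform R (@nS F C)).
Local Notation times_ := (ext_bil R (@times F C)).
Local Notation SH_ := (ext_bil R (@odotSH F C)).
Local Notation HH_ := (ext_bil R (@odotHH F C)).
Local Notation bSH_ := (ext_bil R (@bracketSH F C)).
Local Notation bHH_ := (ext_bil R (@bracketHH F C)).
Local Notation inS_ := (ext_lin R (@inS F C)).
Local Notation inH_ := (ext_lin R (@inH F C)).
Local Notation outS_ := (ext_lin R (@outS F C)).
Local Notation outH_ := (ext_lin R (@outH F C)).
Local Notation inv_ := (ext_lin R (smirnov_involution C)).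
Local Notation autC := (@ext_aut F C [::] R).
Local Notation autT := (@ext_aut F T [:: smirnov_involution C] R).

(** * Structure identities over R *)

Lemma ext_nS_in s t : nS_ (ext_in R s) (ext_in R t) = calg_in R (nS s t).
Proof.
by apply: ext_bilform_in => u; [exact: (nS_bilinear C).2
  | exact: (nS_bilinear C).1].
Qed.

(** As for the other identities over R below, both sides are R-linear in each argument, so the
    arguments may be taken one after another in the original F-space, where the identity over F
    applies. *)
Lemma ext_mul_skew (s t : ext R S) :
  mulC_ (val_ s) (val_ t) = half *: (val_ (comm_ s t) - nS_ s t *: one_).
Proof.
move: s; apply: ext_lift_unique => [||s]; [by linearity|by linearity|].
move: t; apply: ext_lift_unique => [||t]; [by linearity|by linearity|].
rewrite !(ext_lin_in, ext_bil_in) mul_skew // ext_nS_in.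
by rewrite ext_inZ ext_inD ext_inN ext_inZ.
Qed.

Lemma ext_imagE (x : ext R C) : x = (half * trace_ x) *: one_ + val_ (imag_ x).
Proof.
move: x; apply: ext_lift_unique => [||x] //=.
  apply: linear_add; last by linearity.
  by apply: linear_scalel => a x y; rewrite ext_form_scalar mulrDr mulrCA.
rewrite !ext_lin_in ext_form_in; last by move=> a u v; rewrite polarPl.
by rewrite -rmorphM -ext_inZ -ext_inD -imagE.
Qed.

Lemma ext_imag_val (s : ext R S) : imag_ (val_ s) = s.
Proof.
move: s; apply: ext_lift_unique => [||s]; [by linearity|by linearity|].
by rewrite !ext_lin_in /= imag_skew.
Qed.

Lemma ext_odotSH_times s s1 s2 : SH_ s (times_ s1 s2) =
  - (nS_ s1 s2 *: s) - half *: (nS_ s s1 *: s2 + nS_ s s2 *: s1).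
Proof.
move: s; apply: ext_lift_unique => [||s]; [by linearity|by linearity|].
move: s1; apply: ext_lift_unique => [||s1]; [by linearity|by linearity|].
move: s2; apply: ext_lift_unique => [||s2]; [by linearity|by linearity|].
rewrite !ext_bil_in /= odotSH_times !ext_nS_in.
by rewrite !(ext_inD, ext_inN, ext_inZ).
Qed.

Lemma ext_odotHH_times s1 s2 s3 s4 : HH_ (times_ s1 s2) (times_ s3 s4) =
  calg_in R 4^-1 *: (times_ (comm_ s1 s3) (comm_ s2 s4)
     + times_ (comm_ s1 s4) (comm_ s2 s3))
  - nS_ s1 s2 *: times_ s3 s4 - nS_ s3 s4 *: times_ s1 s2.
Proof.
move: s1; apply: ext_lift_unique => [||s1]; [by linearity|by linearity|].
move: s2; apply: ext_lift_unique => [||s2]; [by linearity|by linearity|].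
move: s3; apply: ext_lift_unique => [||s3]; [by linearity|by linearity|].
move: s4; apply: ext_lift_unique => [||s4]; [by linearity|by linearity|].
rewrite !ext_bil_in /= odotHH_times !ext_nS_in.
by rewrite !(ext_inD, ext_inN, ext_inZ).
Qed.

Lemma ext_bracketSH_times s s1 s2 : bSH_ s (times_ s1 s2) =
  times_ (comm_ s s1) s2 + times_ s1 (comm_ s s2).
Proof.
move: s; apply: ext_lift_unique => [||s]; [by linearity|by linearity|].
move: s1; apply: ext_lift_unique => [||s1]; [by linearity|by linearity|].
move: s2; apply: ext_lift_unique => [||s2]; [by linearity|by linearity|].
by rewrite !ext_bil_in /= bracketSH_times ext_inD.
Qed.

Lemma ext_bracketHH_times s1 s2 s3 s4 : bHH_ (times_ s1 s2) (times_ s3 s4) =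
  - (half *: (nS_ s1 s3 *: comm_ s2 s4 + nS_ s1 s4 *: comm_ s2 s3
              + nS_ s2 s3 *: comm_ s1 s4 + nS_ s2 s4 *: comm_ s1 s3)).
Proof.
move: s1; apply: ext_lift_unique => [||s1]; [by linearity|by linearity|].
move: s2; apply: ext_lift_unique => [||s2]; [by linearity|by linearity|].
move: s3; apply: ext_lift_unique => [||s3]; [by linearity|by linearity|].
move: s4; apply: ext_lift_unique => [||s4]; [by linearity|by linearity|].
rewrite !ext_bil_in /= bracketHH_times !ext_nS_in.
by rewrite !(ext_inD, ext_inN, ext_inZ).
Qed.

Lemma ext_timesC s t : times_ s t = times_ t s.
Proof.
move: s; apply: ext_lift_unique => [||s]; [by linearity|by linearity|].
move: t; apply: ext_lift_unique => [||t]; [by linearity|by linearity|].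
by rewrite !ext_bil_in /= timesC.
Qed.

(** The elements [bas i \x bas j] span H over F, hence their images span the extension of H over
    R. *)
Lemma ext_symsq_unique (N : lmodType R) (f g : ext R H -> N) :
  linear f -> linear g -> (forall s t, f (times_ s t) = g (times_ s t)) ->
  f =1 g.
Proof.
move=> fL gL fg; apply: ext_lift_unique => // q; have [c ->] := symsq_sum q.
pose f' : {linear ext R H -> N} :=
  HB.pack f (GRing.isLinear.Build R (ext R H) N _ f fL).
pose g' : {linear ext R H -> N} :=
  HB.pack g (GRing.isLinear.Build R (ext R H) N _ g gL).
rewrite !(big_morph _ (@ext_inD _ R H) (ext_in0 R H)).
rewrite -[f]/(f' : _ -> _) -[g]/(g' : _ -> _) !linear_sum.
apply: eq_bigr => i _; rewrite !(big_morph _ (@ext_inD _ R H) (ext_in0 R H)).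
rewrite !linear_sum; apply: eq_bigr => j _.
by rewrite ext_inZ !linearZ /= -ext_bil_in fg.
Qed.

(** * The decomposition of T(C) over R and its product by components *)

Lemma outS_inS (s : ext R S) : outS_ (inS_ s) = s.
Proof. by rewrite ext_lin_comp ext_lin_id. Qed.
Lemma outH_inH (q : ext R H) : outH_ (inH_ q) = q.
Proof. by rewrite ext_lin_comp ext_lin_id. Qed.
Lemma outS_inH (q : ext R H) : outS_ (inH_ q) = 0.
Proof. by rewrite ext_lin_comp ext_lin0. Qed.
Lemma outH_inS (s : ext R S) : outH_ (inS_ s) = 0.
Proof. by rewrite ext_lin_comp ext_lin0. Qed.

Lemma ext_smirnovE (x : ext R T) : x = inH_ (outH_ x) + inS_ (outS_ x).
Proof.
move: x; apply: ext_lift_unique => [||x]; [by linearity|by linearity|].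
rewrite !ext_lin_in /= -ext_inD; congr ext_in.
by case: x => q s; congr pair; rewrite /= ?addr0 ?add0r.
Qed.

Lemma ext_involution (x : ext R T) : inv_ x = inH_ (outH_ x) + inS_ (- outS_ x).
Proof.
move: x; apply: ext_lift_unique => [||x]; [by linearity|by linearity|].
rewrite !ext_lin_in /= -ext_inN ext_lin_in -ext_inD; congr ext_in.
case: x => q s; rewrite smirnov_involutionE.
by congr pair; rewrite /= ?addr0 ?add0r.
Qed.

Lemma outH_add q s : outH_ (inH_ q + inS_ s) = q.
Proof. by rewrite linearD /= outH_inH outH_inS addr0. Qed.

Lemma outS_add q s : outS_ (inH_ q + inS_ s) = s.
Proof. by rewrite linearD /= outS_inH outS_inS add0r. Qed.

Lemma ext_mulSS s t :
  mulT_ (inS_ s) (inS_ t) = inH_ (times_ s t) + inS_ (half *: comm_ s t).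
Proof.
move: s; apply: ext_lift_unique => [||s]; [by linearity|by linearity|].
move: t; apply: ext_lift_unique => [||t]; [by linearity|by linearity|].
rewrite !(ext_lin_in, ext_bil_in) -ext_inZ ext_lin_in -ext_inD; congr ext_in.
rewrite smirnov_mulE; congr pair;
by rewrite /= !(linear0l, linear0r, addr0, add0r, oppr0, scaler0).
Qed.

Lemma ext_mulSH s q :
  mulT_ (inS_ s) (inH_ q) = inS_ (SH_ s q) + inH_ (half *: bSH_ s q).
Proof.
move: s; apply: ext_lift_unique => [||s]; [by linearity|by linearity|].
move: q; apply: ext_lift_unique => [||q]; [by linearity|by linearity|].
rewrite !(ext_lin_in, ext_bil_in) -ext_inZ ext_lin_in -ext_inD; congr ext_in.
rewrite smirnov_mulE; congr pair;
by rewrite /= !(linear0l, linear0r, addr0, add0r, oppr0, scaler0).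
Qed.

Lemma ext_mulHS s q :
  mulT_ (inH_ q) (inS_ s) = inS_ (SH_ s q) - inH_ (half *: bSH_ s q).
Proof.
move: s; apply: ext_lift_unique => [||s]; [by linearity|by linearity|].
move: q; apply: ext_lift_unique => [||q]; [by linearity|by linearity|].
rewrite !(ext_lin_in, ext_bil_in) -ext_inZ ext_lin_in -ext_inN -ext_inD.
congr ext_in; rewrite smirnov_mulE; congr pair;
by rewrite /= !(linear0l, linear0r, addr0, add0r, oppr0, scaler0, scalerN).
Qed.

Lemma ext_mulHH p q :
  mulT_ (inH_ p) (inH_ q) = inH_ (HH_ p q) + inS_ (half *: bHH_ p q).
Proof.
move: p; apply: ext_lift_unique => [||p]; [by linearity|by linearity|].
move: q; apply: ext_lift_unique => [||q]; [by linearity|by linearity|].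
rewrite !(ext_lin_in, ext_bil_in) -ext_inZ ext_lin_in -ext_inD; congr ext_in.
rewrite smirnov_mulE; congr pair;
by rewrite /= !(linear0l, linear0r, addr0, add0r, oppr0, scaler0).
Qed.

(** Characteristic different from 2, in the form used over R: writing x as [half *: x + half *: x]
    allows 2 to be cancelled. *)
Lemma half_add : half + half = 1.
Proof.
have e : 2^-1 + 2^-1 = 1 :> F.
  have -> : 2^-1 + 2^-1 = 2%:R * 2^-1 :> F by ring.
  exact: mulfV (two_neq0 char2).
by rewrite -(rmorphD (calg_in R)) e rmorph1.
Qed.

(* Symmetrization induces a linear section H -> S (x) S, which spares a check
   that the formula for [symsq_map] respects the relations defining H. *)
Definition symtens (s t : S) : tensor S S := 2^-1 *: (tens s t + tens t s).

Lemma symtens_bilinear : bilinear_for *:%R *:%R symtens.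
Proof.
split=> [t|s] a x y;
  rewrite /symtens linearPl linearPr /= addrACA -(scalerDr a);
  by rewrite [LHS]scalerDr !scalerA [a * _]mulrC.
Qed.

Definition symsq_map (psi : ext R S -> ext R S) : ext R H -> ext R H :=
  ext_lift (fun q : H => \sum_i \sum_j calg_in R (hlift symtens q i j) *:
    times_ (psi (ext_in R (bas i))) (psi (ext_in R (bas j)))).

Lemma symsq_map_linear psi : linear (symsq_map psi).
Proof. exact: ext_lift_linear. Qed.

Lemma symsq_map_times psi s t : linear psi ->
  symsq_map psi (times_ s t) = times_ (psi s) (psi t).
Proof.
move=> psiL.
have sqL := symsq_map_linear psi.
move: s; apply: ext_lift_unique => [||s]; [by linearity|by linearity|].
move: t; apply: ext_lift_unique => [||t]; [by linearity|by linearity|].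
pose psi' : {linear ext R S -> ext R S} :=
  HB.pack psi (GRing.isLinear.Build R (ext R S) (ext R S) _ psi psiL).
have sumE (u v : S) : times_ (psi (ext_in R u)) (psi (ext_in R v)) =
    \sum_i \sum_j calg_in R (crd u i * crd v j) *:
      times_ (psi (ext_in R (bas i))) (psi (ext_in R (bas j))).
  rewrite [ext_in R u]ext_sum [ext_in R v]ext_sum -[psi]/(psi' : _ -> _).
  rewrite !(linear_sum psi') ext_bil_suml; apply: eq_bigr => i _.
  rewrite linear_sum; apply: eq_bigr => j _.
  by rewrite !linearZ /= ext_bilZl !mxE scalerA rmorphM mulrC.
rewrite ext_bil_in /symsq_map ext_lift_in => [|a u v]; last first.
  rewrite scaler_sumr -big_split; apply: eq_bigr => i _ /=.
  rewrite scaler_sumr -big_split; apply: eq_bigr => j _ /=.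
  by rewrite linearP !mxE rmorphD rmorphM scalerDl scalerA.
(* Split the right side into two halves and exchange the factors in the second, to match the two
   terms of [symtens]. *)
rewrite -[RHS]scale1r -half_add scalerDl {2}ext_timesC !sumE.
rewrite !scaler_sumr -big_split; apply: eq_bigr => i _ /=.
rewrite !scaler_sumr -big_split; apply: eq_bigr => j _ /=.
rewrite hlift_times; first last.
- by move=> u v; rewrite /symtens addrC.
- exact: symtens_bilinear.
by rewrite !scalerA -scalerDl !mxE -!rmorphM -rmorphD mulrDr.
Qed.

(** The R-points of the functor through which the two automorphism functors are compared. *)
Definition skew_sym (psi : ext R S -> ext R S) : Prop :=
  [/\ linear psi, bijective psi, {morph psi : s t / comm_ s t}
    & forall s t, nS_ (psi s) (psi t) = nS_ s t].

Lemma half_scaleI (V : lmodType R) (x y : V) : half *: x = half *: y -> x = y.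
Proof.
move=> e; rewrite -[x]scale1r -[y]scale1r -half_add !scalerDl.
by rewrite e.
Qed.

Lemma ext_comm_self s : comm_ s s = 0.
Proof.
have commC_ u v : comm_ u v = - comm_ v u.
  move: u; apply: ext_lift_unique => [||u]; [by linearity|by linearity|].
  move: v; apply: ext_lift_unique => [||v]; [by linearity|by linearity|].
  by rewrite !ext_bil_in /= commC ext_inN.
by rewrite -[LHS]scale1r -half_add scalerDl {2}commC_ scalerN subrr.
Qed.

Lemma ext_mul1 x : mulC_ one_ x = x.
Proof.
move: x; apply: ext_lift_unique => [||x]; [by linearity|by linearity|].
by rewrite ext_bil_in cay_mul1.
Qed.

Lemma ext_mulr1 x : mulC_ x one_ = x.
Proof.
move: x; apply: ext_lift_unique => [||x]; [by linearity|by linearity|].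
by rewrite ext_bil_in cay_mulr1.
Qed.

Lemma ext_imag_one : imag_ one_ = 0.
Proof. by rewrite ext_lin_in /= imag_one // ext_in0. Qed.

(** Taking traces gives 2a = 0, and 2 is invertible in R. *)
Lemma ext_one_free a : a *: one_ = 0 -> a = 0.
Proof.
move=> a0; pose tr := ext_form R (fun x => polar (@cay_norm F C) x (cay_one C)).
have [_ _ tr0 trZ] := linear_morphs (V := R^o)
   (ext_form_scalar (fun x => polar (@cay_norm F C) x (cay_one C)) : scalar tr).
have := tr0; rewrite -a0 trZ /tr ext_form_in => [|b u v]; last exact: polarPl.
rewrite polar_one // rmorph_nat => a2.
have -> : a = half * (a * 2%:R).
  by rewrite mulr_natr mulr2n mulrDr -mulrDl half_add mul1r.
by rewrite [_ * 2%:R]a2 mulr0.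
Qed.

(** * Automorphisms of C over R restrict to S *)

Section AutC.
Variable f : autC.

Let psi (s : ext R S) : ext R S := imag_ (f (val_ s)).
Let re (s : ext R S) : R := half * trace_ (f (val_ s)).

(** With g inverse to f, 1 = f(g(1)) = f(1 g(1)) = f(1) f(g(1)) = f(1). *)
Lemma autC_one : f one_ = one_.
Proof.
have [g fK gK] := aut_bijective f.
by rewrite -[RHS]gK -{1}[g one_]ext_mul1 aut_mul gK ext_mulr1.
Qed.

Lemma autC_decomp s : f (val_ s) = re s *: one_ + val_ (psi s).
Proof. exact: ext_imagE. Qed.

Lemma autC_re_skew s : re s *: s = 0.
Proof.
have [imD _ im0 imZ] := linear_morphs (@ext_lin_linear _ R _ _ (@imag F C)).
have [fD _ _ fZ] := linear_morphs (aut_linear f).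
(* Apply f to the fact that s^2 is a scalar. The skew part of (re(s) 1 + psi(s))^2 is 2 re(s)
   psi(s), since psi(s)^2 is a scalar too. *)
have re_psi : re s *: psi s = 0.
  have := congr1 f (ext_mul_skew s s).
  rewrite aut_mul autC_decomp ext_comm_self linear0 add0r -scaleNr.
  rewrite !fZ autC_one !(ext_bilDl, linearD) /= !ext_bilZl !linearZ /=.
  rewrite ext_mul1 ext_mulr1 ext_mul1 ext_mul_skew // ext_comm_self.
  rewrite linear0 add0r -scaleNr => /(congr1 imag_).
  rewrite !(imD, imZ) ext_imag_one !scaler0 ext_imag_val // !add0r addr0 => e.
  by rewrite -[LHS]scale1r -half_add scalerDl -scalerDr e scaler0.
have [_ _ val0 valZ] := linear_morphs (@ext_lin_linear _ R _ _ (@skew_val F C)).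
(* Hence re(s) f(s) is the scalar re(s)^2; cancelling f and taking skew parts leaves re(s) s = 0. *)
have : f (re s *: val_ s) = f ((re s * re s) *: one_).
  by rewrite !fZ autC_one autC_decomp scalerDr -valZ re_psi val0 addr0 scalerA.
move/(bij_inj (aut_bijective f))/(congr1 imag_).
by rewrite !imZ ext_imag_val // ext_imag_one scaler0.
Qed.

Lemma autC_skew s : f (val_ s) = val_ (psi s).
Proof.
suff re0 : re s = 0 by rewrite autC_decomp re0 scale0r add0r.
apply: ext_scalar_eq0 s => [a s t|i].
  by rewrite /re !linearP /= ext_form_scalar mulrDr mulrCA.
(* The i-th coordinate of a basis vector is 1, so it can be cancelled; the coordinates of a general
   s may be zero divisors in R. *)
have /rowP/(_ i) := autC_re_skew (ext_in R (bas i)).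
by rewrite ext_in_bas !mxE !eqxx mulr1.
Qed.

(** Compare f(st) with f(s) f(t) by [ext_mul_skew]: the skew parts give the commutator, and the
    coefficients of 1, which is free over R, give the form. *)
Lemma autC_comm_norm s t : psi (comm_ s t) = comm_ (psi s) (psi t) /\
  nS_ (psi s) (psi t) = nS_ s t.
Proof.
have [imD imN im0 imZ] := linear_morphs (@ext_lin_linear _ R _ _ (@imag F C)).
have [fD fN _ fZ] := linear_morphs (aut_linear f).
have := aut_mul f (val_ s) (val_ t).
rewrite !autC_skew !ext_mul_skew // fZ fD fN fZ autC_one => /half_scaleI e.
have e1 : psi (comm_ s t) = comm_ (psi s) (psi t).
  have := congr1 imag_ e; rewrite autC_skew.
  rewrite !(imD, imN, imZ) ext_imag_one !ext_imag_val //.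
  by rewrite !scaler0 oppr0 !addr0.
split=> //; move: e; rewrite autC_skew e1 => /addrI/oppr_inj/eqP.
rewrite eq_sym -subr_eq0 -scalerBl => /eqP/ext_one_free/eqP.
by rewrite subr_eq0 => /eqP.
Qed.

End AutC.

Lemma autC_sym (f : autC) : skew_sym (fun s => imag_ (f (val_ s))).
Proof.
split=> [a s t||s t|s t].
- by rewrite !linearP.
- exists (fun s => imag_ (aut_inv f (val_ s))) => s; rewrite -autC_skew.
    by rewrite aut_invK ext_imag_val.
  by rewrite aut_invVK ext_imag_val.
- by case: (autC_comm_norm f s t).
- by case: (autC_comm_norm f s t).
Qed.

Lemma autC_inj (f g : autC) : (forall s, f (val_ s) = g (val_ s)) -> f = g.
Proof.
move=> fg; apply: ext_autP => x; rewrite (ext_imagE x).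
by rewrite !linearD !linearZ /= !autC_one fg.
Qed.

Lemma skew_sym_inv psi psi' : skew_sym psi ->
  cancel psi psi' -> cancel psi' psi -> skew_sym psi'.
Proof.
case=> psiL _ psiM psiN psiK psiVK; split.
- exact: bijective_linear psiL psiK psiVK.
- by exists psi.
- by move=> s t; apply: (can_inj psiK); rewrite psiM !psiVK.
- by move=> s t; rewrite -psiN !psiVK.
Qed.

(** * Extending a symmetry of S to C *)

Section CayleyExtension.
Variable psi : ext R S -> ext R S.

Definition cayley_ext (x : ext R C) : ext R C :=
  (half * trace_ x) *: one_ + val_ (psi (imag_ x)).

Hypothesis psi_sym : skew_sym psi.
Let psiL : linear psi. Proof. by case: psi_sym. Qed.

Lemma cayley_ext_linear : linear cayley_ext.
Proof.
apply: linear_add; last by linearity.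
by apply: linear_scalel => a x y; rewrite ext_form_scalar mulrDr mulrCA.
Qed.

Lemma cayley_ext_one : cayley_ext one_ = one_.
Proof.
have [_ _ psi0 _] := linear_morphs psiL.
rewrite /cayley_ext ext_imag_one // psi0 linear0 addr0.
rewrite ext_form_in => [|b u v]; last exact: polarPl.
rewrite polar_one // -(rmorphM (calg_in R)) (mulVf (two_neq0 char2)).
by rewrite rmorph1 scale1r.
Qed.

Lemma cayley_ext_val s : cayley_ext (val_ s) = val_ (psi s).
Proof.
have tr0 : trace_ (val_ s) = 0.
  apply: (ext_scalar_eq0 (l := fun s => trace_ (val_ s))) => [a x y|i].
    by rewrite linearP ext_form_scalar.
  rewrite ext_lin_in ext_form_in => [|b u v]; last exact: polarPl.
  have := subvsP (bas i : S); rewrite skew_trace // => /eqP->.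
  exact: rmorph0.
by rewrite /cayley_ext tr0 mulr0 scale0r add0r ext_imag_val.
Qed.

Lemma cayley_extE a s :
  cayley_ext (a *: one_ + val_ s) = a *: one_ + val_ (psi s).
Proof. by rewrite cayley_ext_linear cayley_ext_one cayley_ext_val. Qed.

Lemma cayley_ext_mul : {morph cayley_ext : x y / mulC_ x y}.
Proof.
have [_ _ psiM psiN] := psi_sym.
have [fD fN _ fZ] := linear_morphs cayley_ext_linear.
move=> x y; rewrite (ext_imagE x) (ext_imagE y) !cayley_extE.
set a := half * _; set b := half * _; set s := imag_ x; set t := imag_ y.
(* Stated for arbitrary u and v, so that it expands the product both before and after psi is
   applied. *)
have mulE u v : mulC_ (a *: one_ + val_ u) (b *: one_ + val_ v) =
   (b * a) *: one_ + a *: val_ v + (b *: val_ u + mulC_ (val_ u) (val_ v)).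
  rewrite ext_bilDl !linearD /= !ext_bilZl !linearZ /=.
  by rewrite !ext_mul1 !ext_mulr1 scalerA.
rewrite !mulE !ext_mul_skew // !(fD, fN, fZ).
by rewrite cayley_ext_one !cayley_ext_val psiM psiN.
Qed.

End CayleyExtension.

Lemma cayley_extK psi psi' : skew_sym psi -> skew_sym psi' ->
  cancel psi psi' -> cancel (cayley_ext psi) (cayley_ext psi').
Proof.
move=> psiS psiS' psiK x; rewrite [in LHS](ext_imagE x) !cayley_extE //.
by rewrite psiK -ext_imagE.
Qed.

Lemma sym_autC psi : skew_sym psi ->
  exists f : autC, forall s, f (val_ s) = val_ (psi s).
Proof.
move=> psiS; have [_ [psi' psiK psiVK] _ _] := psiS.
have psiS' := skew_sym_inv psiS psiK psiVK.
have bij : bijective (cayley_ext psi).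
  by exists (cayley_ext psi'); exact: cayley_extK.
exists (@ExtAut F C [::] R _ (cayley_ext_linear psiS) bij (cayley_ext_mul psiS)
  (fun _ _ => ltac:(by []))) => s.
exact: cayley_ext_val.
Qed.

(** * Extending a symmetry of S to T(C) *)

Section SmirnovExtension.
Variable psi : ext R S -> ext R S.
Local Notation chi := (symsq_map psi).

Definition smirnov_ext (x : ext R T) : ext R T :=
  inH_ (chi (outH_ x)) + inS_ (psi (outS_ x)).

Hypothesis psi_sym : skew_sym psi.
Let psiL : linear psi. Proof. by case: psi_sym. Qed.
Let chiL := symsq_map_linear psi.

Lemma smirnov_ext_linear : linear smirnov_ext.
Proof. by rewrite /smirnov_ext; linearity. Qed.

Lemma smirnov_extE q s :
  smirnov_ext (inH_ q + inS_ s) = inH_ (chi q) + inS_ (psi s).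
Proof. by rewrite /smirnov_ext outH_add outS_add. Qed.

(** This and the next three compatibilities are checked on the generators [times_ s1 s2], where the
    formulas involve only the commutator, the form and [times_]. *)
Lemma symsq_map_odotSH s q : psi (SH_ s q) = SH_ (psi s) (chi q).
Proof.
have [_ _ _ psiN] := psi_sym; have [fD fN _ fZ] := linear_morphs psiL.
move: q; apply: ext_symsq_unique => [||s1 s2]; [by linearity|by linearity|].
rewrite symsq_map_times // !ext_odotSH_times //.
by rewrite !(fD, fN, fZ) !psiN.
Qed.

Lemma symsq_map_bracketSH s q : chi (bSH_ s q) = bSH_ (psi s) (chi q).
Proof.
have [_ _ psiM _] := psi_sym; have [fD _ _ _] := linear_morphs chiL.
move: q; apply: ext_symsq_unique => [||s1 s2]; [by linearity|by linearity|].
rewrite symsq_map_times // !ext_bracketSH_times // fD !symsq_map_times //.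
by rewrite !psiM.
Qed.

Lemma symsq_map_odotHH p q : chi (HH_ p q) = HH_ (chi p) (chi q).
Proof.
have [_ _ psiM psiN] := psi_sym; have [fD fN _ fZ] := linear_morphs chiL.
move: p; apply: ext_symsq_unique => [||s1 s2]; [by linearity|by linearity|].
move: q; apply: ext_symsq_unique => [||s3 s4]; [by linearity|by linearity|].
rewrite !symsq_map_times // !ext_odotHH_times //.
by rewrite !(fD, fN, fZ) !symsq_map_times // !psiM !psiN.
Qed.

Lemma symsq_map_bracketHH p q : psi (bHH_ p q) = bHH_ (chi p) (chi q).
Proof.
have [_ _ psiM psiN] := psi_sym; have [fD fN _ fZ] := linear_morphs psiL.
move: p; apply: ext_symsq_unique => [||s1 s2]; [by linearity|by linearity|].
move: q; apply: ext_symsq_unique => [||s3 s4]; [by linearity|by linearity|].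
rewrite !symsq_map_times // !ext_bracketHH_times //.
by rewrite !(fD, fN, fZ) !psiM !psiN.
Qed.

Lemma smirnov_ext_inH q : smirnov_ext (inH_ q) = inH_ (chi q).
Proof.
have [_ _ psi0 _] := linear_morphs psiL.
by have := smirnov_extE q 0; rewrite psi0 !linear0 !addr0.
Qed.

Lemma smirnov_ext_inS s : smirnov_ext (inS_ s) = inS_ (psi s).
Proof.
have [_ _ chi0 _] := linear_morphs chiL.
by have := smirnov_extE 0 s; rewrite chi0 !linear0 !add0r.
Qed.

Lemma smirnov_ext_mul : {morph smirnov_ext : x y / mulT_ x y}.
Proof.
have [_ _ psiM _] := psi_sym.
have [fD fN _ fZ] := linear_morphs smirnov_ext_linear.
have [_ _ _ psiZ] := linear_morphs psiL.
have [_ _ _ chiZ] := linear_morphs chiL.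
move=> x y; rewrite (ext_smirnovE x) (ext_smirnovE y) !smirnov_extE.
rewrite !(ext_bilDl, linearD) /= !(ext_mulHH, ext_mulHS, ext_mulSH, ext_mulSS).
rewrite !(fD, fN) !(smirnov_ext_inH, smirnov_ext_inS).
rewrite !(psiZ, chiZ) symsq_map_odotHH symsq_map_bracketHH !symsq_map_odotSH.
by rewrite !symsq_map_bracketSH psiM symsq_map_times.
Qed.

Lemma smirnov_ext_inv op : op \in [:: smirnov_involution C] ->
  {morph smirnov_ext : x / ext_lin R op x}.
Proof.
have [_ psiN _ _] := linear_morphs psiL.
rewrite inE => /eqP-> x; rewrite !ext_involution smirnov_extE psiN.
by rewrite outH_add outS_add.
Qed.

End SmirnovExtension.

Lemma smirnov_extK psi psi' : skew_sym psi -> skew_sym psi' ->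
  cancel psi psi' -> cancel (smirnov_ext psi) (smirnov_ext psi').
Proof.
move=> [psiL _ _ _] [psiL' _ _ _] psiK x.
rewrite [RHS]ext_smirnovE {2}/smirnov_ext smirnov_extE psiK; congr (inH_ _ + _).
move: (outH_ x); have chiL := symsq_map_linear psi.
have chiL' := symsq_map_linear psi'.
apply: ext_symsq_unique => [||s t]; [by linearity|by linearity|].
by rewrite !symsq_map_times // !psiK.
Qed.

Lemma sym_autT psi : skew_sym psi ->
  exists f : autT, forall s, f (inS_ s) = inS_ (psi s).
Proof.
move=> psiS; have [_ [psi' psiK psiVK] _ _] := psiS.
have psiS' := skew_sym_inv psiS psiK psiVK.
have bij : bijective (smirnov_ext psi).
  by exists (smirnov_ext psi'); exact: smirnov_extK.
exists (@ExtAut F T _ R _ (smirnov_ext_linear psiS) bij (smirnov_ext_mul psiS)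
  (smirnov_ext_inv psiS)) => s.
exact: smirnov_ext_inS.
Qed.

(** * Automorphisms of T(C) over R restrict to S *)

Lemma double_eq0 (V : lmodType R) (x : V) : x = - x -> x = 0.
Proof.
by move=> e; rewrite -[x]scale1r -half_add scalerDl {1}e scalerN addNr.
Qed.

Lemma autT_involution (f : autT) x : f (inv_ x) = inv_ (f x).
Proof. by rewrite (aut_ops f) // inE. Qed.

(** The involution negates s and fixes H, so the H-component of f(s) equals its own opposite and
    vanishes. *)
Lemma autT_inS (f : autT) s : f (inS_ s) = inS_ (outS_ (f (inS_ s))).
Proof.
have := autT_involution f (inS_ s).
rewrite !ext_involution outH_inS outS_inS linear0.
have [_ inSN _ _] := linear_morphs (@ext_lin_linear _ R _ _ (@inS F C)).
rewrite add0r inSN linearN /= {1}(ext_smirnovE (f _)) => /(congr1 outH_).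
rewrite linearN /= !outH_add => /esym/double_eq0 e.
by rewrite [LHS]ext_smirnovE e linear0 add0r.
Qed.

Lemma autT_inH (f : autT) q : f (inH_ q) = inH_ (outH_ (f (inH_ q))).
Proof.
have := autT_involution f (inH_ q).
rewrite !ext_involution outH_inH outS_inH oppr0.
rewrite linear0 addr0 {1}(ext_smirnovE (f _)) => /(congr1 outS_).
rewrite !outS_add => /double_eq0 e.
by rewrite [LHS]ext_smirnovE e linear0 addr0.
Qed.

Section AutT.
Variable f : autT.

Let psi (s : ext R S) : ext R S := outS_ (f (inS_ s)).
Let chi (q : ext R H) : ext R H := outH_ (f (inH_ q)).

Let f_inS s : f (inS_ s) = inS_ (psi s). Proof. exact: autT_inS. Qed.
Let f_inH q : f (inH_ q) = inH_ (chi q). Proof. exact: autT_inH. Qed.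

Lemma autT_sym_linear : linear psi.
Proof. by move=> a s t; rewrite /psi !linearP. Qed.

Lemma autT_sym_SS s t : psi (comm_ s t) = comm_ (psi s) (psi t) /\
  chi (times_ s t) = times_ (psi s) (psi t).
Proof.
have [_ _ _ psiZ] := linear_morphs autT_sym_linear.
have := aut_mul f (inS_ s) (inS_ t).
rewrite ext_mulSS !f_inS ext_mulSS linearD /= f_inH f_inS psiZ => e.
split; last by have := congr1 outH_ e; rewrite !outH_add.
by apply: half_scaleI; have := congr1 outS_ e; rewrite !outS_add.
Qed.

Lemma autT_sym_SH s q : psi (SH_ s q) = SH_ (psi s) (chi q).
Proof.
have := aut_mul f (inS_ s) (inH_ q).
rewrite ext_mulSH f_inS f_inH ext_mulSH linearD /= f_inH f_inS.
by rewrite ![inS_ _ + _]addrC => /(congr1 outS_); rewrite !outS_add.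
Qed.

Lemma autT_sym_bijective : bijective psi.
Proof.
exists (fun s => outS_ (aut_inv f (inS_ s))) => s; rewrite /psi -autT_inS.
  by rewrite aut_invK outS_inS.
by rewrite aut_invVK outS_inS.
Qed.

Let defect s t : R := nS_ (psi s) (psi t) - nS_ s t.

Lemma defect_identity s s1 s2 : defect s1 s2 *: s +
  half *: (defect s s1 *: s2 + defect s s2 *: s1) = 0.
Proof.
have [psiD psiN psi0 psiZ] := linear_morphs autT_sym_linear.
(* The image under psi of the left side is the difference between the two expansions of psi(s o (s1
   x s2)), one before and one after moving psi inside. *)
apply: (bij_inj autT_sym_bijective); rewrite psi0.
have := autT_sym_SH s (times_ s1 s2); rewrite (autT_sym_SS s1 s2).2.
rewrite !ext_odotSH_times // !(psiD, psiN, psiZ) => /eqP.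
rewrite -subr_eq0 => /eqP<-; rewrite /defect !scalerBl.
rewrite [in LHS]addrACA -opprD scalerBr.
by rewrite [in RHS]opprD !opprK [RHS]addrC [RHS]addrACA.
Qed.

Lemma defect0 s t : defect s t = 0.
Proof.
have defl u : scalar (defect ^~ u).
  move=> a x y; rewrite /defect autT_sym_linear !ext_bilform_scalarl; ring.
have defr u : scalar (defect u).
  move=> a x y; rewrite /defect autT_sym_linear !ext_bilform_scalarr; ring.
apply: (ext_scalar_eq0 (defl t)) => i; apply: (ext_scalar_eq0 (defr _)) => j.
have [k ki kj] : exists2 k, k != i & k != j.
  by apply: ord_avoid2; apply: leq_trans (dim_skew C).
(* Since k differs from i and j, the k-th coordinate of this identity involves only its first term
   and equals the defect of [bas i] and [bas j]. *)
have /rowP/(_ k) := defect_identity (ext_in R (bas k))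
  (ext_in R (bas i)) (ext_in R (bas j)).
rewrite !ext_in_bas !mxE !eqxx (negbTE ki) (negbTE kj) /=.
by rewrite !mulr0 addr0 mulr0 addr0 mulr1.
Qed.

Lemma autT_sym : skew_sym psi.
Proof.
split=> [||s t|s t].
- exact: autT_sym_linear.
- exact: autT_sym_bijective.
- by case: (autT_sym_SS s t).
- by apply/eqP; rewrite -subr_eq0; apply/eqP/defect0.
Qed.

End AutT.

(** S generates T(C): by [autT_sym_SS] the value of f at [times_ s t] is determined by its values at
    s and t, and such elements span H over R. *)
Lemma autT_inj (f g : autT) : (forall s, f (inS_ s) = g (inS_ s)) -> f = g.
Proof.
move=> fg; apply: ext_autP => x; rewrite (ext_smirnovE x) !linearD /= fg.
congr (_ + _); move: (outH_ x).
have fL := aut_linear f; have gL := aut_linear g.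
apply: ext_symsq_unique => [||s t]; [by linearity|by linearity|].
rewrite (autT_inH f) (autT_inH g) (autT_sym_SS f s t).2 (autT_sym_SS g s t).2.
by rewrite !fg.
Qed.

End Symmetries.

(** * The isomorphism *)

Section Isomorphism.
Variables (F : fieldType) (C : cayley F).
Hypothesis char2 : 2%N \notin [pchar F].
Local Notation S := (subvs_of (skew C)).
Local Notation T := (smirnov C).
Local Notation autC := (@ext_aut F C [::]).
Local Notation autT := (@ext_aut F T [:: smirnov_involution C]).
Implicit Type R : commAlg F.

Definition skew_part R (f : autC R) (s : ext R S) : ext R S :=
  ext_lin R (@imag F C) (f (ext_lin R (@skew_val F C) s)).

Lemma autCT_exists R (f : autC R) : exists g : autT R,
  forall s, g (ext_lin R (@inS F C) s) = ext_lin R (@inS F C) (skew_part f s).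
Proof. exact: sym_autT (autC_sym char2 f). Qed.

(** Obtained by choice, yet unique by [autT_inj]; multiplicativity and naturality therefore need
    checking on S only. *)
Definition autCT R (f : autC R) : autT R := sval (cid (autCT_exists f)).

Lemma autCTE R (f : autC R) s :
  autCT f (ext_lin R (@inS F C) s) = ext_lin R (@inS F C) (skew_part f s).
Proof. exact: svalP (cid (autCT_exists f)) s. Qed.

Lemma skew_partE R (f : autC R) s :
  ext_lin R (@skew_val F C) (skew_part f s) = f (ext_lin R (@skew_val F C) s).
Proof. by rewrite [RHS]autC_skew. Qed.

Lemma skew_partM R (f g : autC R) s :
  skew_part (f * g)%g s = skew_part f (skew_part g s).
Proof. by rewrite {2}/skew_part skew_partE. Qed.

Lemma autCT_mul R : {morph @autCT R : f g / (f * g)%g}.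
Proof.
move=> f g; apply: autT_inj => // s; rewrite autCTE skew_partM.
by rewrite -[RHS]/(autCT f (autCT g _)) !autCTE.
Qed.

HB.instance Definition _ R :=
  isMultiplicative.Build (autC R) (autT R) (@autCT R) (@autCT_mul R).

Lemma autCT_natural R R' (h : commAlgHom R R') (f : autC R) :
  autCT (aut_map h f) = aut_map h (autCT f).
Proof.
apply: autT_inj => // s.
have sL := @ext_lin_linear _ R' _ _ (@inS F C).
move: s; apply: ext_lift_unique => [a s t|a s t|s].
- by rewrite !linearP.
- by rewrite !linearP.
(* Write s over R' as the image under h of s over R, where base-changed automorphisms can be
   evaluated. *)
rewrite autCTE -(map_ext_in h) -!map_ext_lin.
rewrite [RHS](aut_map_fun_map _ (aut_linear _)) autCTE map_ext_lin.
congr ext_lin; rewrite /skew_part -map_ext_lin.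
by rewrite [aut_map h f _](aut_map_fun_map _ (aut_linear _)) map_ext_lin.
Qed.

Definition autCT_hom : gfHom (AutGS C) (AutInvGS (smirnov_involution C)) :=
  @GfHom F (AutGS C) (AutInvGS (smirnov_involution C))
    (fun R => @autCT R : {multiplicative autC R -> autT R}) autCT_natural.

(** Injective because f is determined by its skew part; surjective because the symmetry of S induced
    by g extends to C and [autT_inj] identifies the resulting automorphism with g. *)
Lemma autCT_bijective R : bijective (@autCT R).
Proof.
have inj : injective (@autCT R).
  move=> f g fg; apply: autC_inj => // s; rewrite -!skew_partE.
  by rewrite -[skew_part f s]outS_inS -[skew_part g s]outS_inS -!autCTE fg.
have surj (g : autT R) : exists f, autCT f = g.
  have [f fE] := sym_autC char2 (autT_sym char2 g).
  exists f; apply: autT_inj => // s; rewrite autCTE autT_inS //.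
  by rewrite /skew_part fE ext_imag_val.
exists (fun g => sval (cid (surj g))) => [f|g].
  exact/inj/(svalP (cid (surj _))).
exact: svalP (cid (surj g)).
Qed.

End Isomorphism.

Local Close Scope ring_scope.

Theorem theorem4p3 (F : fieldType) (charF : 2 \notin [pchar F]%R)
    (C : cayley F) :
  gf_isomorphic (AutGS C) (AutInvGS (smirnov_involution C)).
Proof.
apply: (gf_isomorphic_bij (Phi := autCT_hom C charF)).
by move=> R; exact: autCT_bijective.
Qed.
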